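(* Let $\alpha>0$ and $-1<x<1$. Write $U_n=R_n^{(\alpha,\alpha)}$ for integers $n\ge 0$. (i) For an integer $k\ge 1$, the minimum $\min_{n\ge 0}U_n(x)$ is attained at degree $k$ (that is, $U_k(x)=\min_{n\ge0}U_n(x)$) if and only if $\xi_{k-1}\le x\le \xi_k$. (ii) For $k\ge1$, the minimum is attained only at degree $k$ when $\xi_{k-1}<x<\xi_k$, and only at the degrees $k$ and $k+1$ when $x=\xi_k$. (iii) For every degree $k$ at which the minimum is attained, $U_0(x)\ge U_1(x)\ge\cdots\ge U_k(x)$.
   Context: For real $a,b>-1$ and integers $n\ge 0$, $R_n^{(a,b)}(x)=P_n^{(a,b)}(x)/P_n^{(a,b)}(1)$, where $P_n^{(a,b)}$ is the Jacobi polynomial of degree $n$ (orthogonal on $[-1,1]$ with respect to the weight $(1-x)^a(1+x)^b$). For the fixed $\alpha$, put $\xi_0=-1$, and for $n\ge 1$ let $\xi_n$ be the largest zero of $R_n^{(\alpha+1,\alpha)}$. (It is classical that $-1=\xi_0<\xi_1<\xi_2<\cdots<1$ and $\xi_n\to 1$.) *)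

(* Defs.v *)
From mathcomp Require Import all_boot all_order all_algebra.
From mathcomp Require Import all_classical all_reals all_analysis.

Set Implicit Arguments.
Unset Strict Implicit.
Unset Printing Implicit Defensive.

Import Order.TTheory GRing.Theory Num.Theory.
Import numFieldNormedType.Exports.

Local Open Scope classical_set_scope.
Local Open Scope ring_scope.

Definition jacobi_weight (R : realType) (a b x : R) : R :=
  (1 - x) `^ a * (1 + x) `^ b.

(* The third clause is the classical normalization P_n(1) = 'C(n + a, n), a
   generalized binomial coefficient.  For a, b > -1 exactly one family P
   satisfies the three clauses. *)
Definition is_jacobi (R : realType) (a b : R) (P : nat -> {poly R}) : Prop :=
  [/\ forall n, size (P n) = n.+1,
      forall m n, m <> n ->
        (\int[lebesgue_measure]_(x in `[-1, 1])
          (jacobi_weight a b x * (P m).[x] * (P n).[x]) = 0)%R &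
      forall n, (P n).[1] = \prod_(i < n) ((a + i.+1%:R) / i.+1%:R)].

(* Meaningful only for a, b > -1, the range in which the family exists and is
   unique. *)
Definition jacobi (R : realType) (a b : R) : nat -> {poly R} :=
  xget (fun=> 0) [set P : nat -> {poly R} | is_jacobi a b P].

Definition jacobiR (R : realType) (a b : R) (n : nat) : {poly R} :=
  (jacobi a b n).[1]^-1 *: jacobi a b n.

(* Meaningful only when p is nonzero and has a real root. *)
Definition largest_root (R : realType) (p : {poly R}) : R :=
  xget 0 [set r | root p r /\ forall s, root p s -> s <= r].

Definition xi (R : realType) (alpha : R) (n : nat) : R :=
  if n is 0 then -1 else largest_root (jacobiR (alpha + 1) alpha n).

Definition min_attained_at (R : realType) (u : nat -> R) (k : nat) : Prop :=
  forall n, u k <= u n.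

(* Main.v *)
Require Import Defs.
From mathcomp Require Import all_boot all_order all_algebra.
From mathcomp Require Import all_classical all_reals all_analysis.
From mathcomp Require Import ring lra.

Set Implicit Arguments.
Unset Strict Implicit.
Unset Printing Implicit Defensive.

Import Order.TTheory GRing.Theory Num.Theory.
Import numFieldNormedType.Exports.

Local Open Scope ring_scope.

(** Fix x and write b = 2 alpha + 1 > 1 and u_n = U_n(x). By the
    Christoffel-Darboux formula U_n - U_(n+1) = (1 - X) K_n, where K_n is a positive
    multiple of R_n^(alpha+1,alpha). So u decreases as long as K_n(x) > 0. The ratio
    K_(n+1) / K_n increases to the right of xi_n ([ratio_incrS]); this yields the
    chain xi_0 < xi_1 < ... and shows that for xi_(k-1) < x <= xi_k the sequence
    decreases strictly up to the degree k, with u_k <= u_(k+1) and equality only at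
    x = xi_k ([is_xi_step], [turning_index]). Every x of the interval lies in one of
    these ranges, and all three claims follow once it is known that u_m > u_k for
    all m >= k + 2 ([gegen_after_turn], [gegen_minima]).

    That inequality rests on an energy. The quantity
    E_n = (1 - x^2) u_(n+1)^2 + (u_n - x u_(n+1))^2 does not increase, because b > 0
    makes the recurrence a damped oscillation: at each step it loses
    (1 - s^2) (u_n - x u_(n+1))^2 with s = (n + 1) / (n + 1 + b) ([energyS]). Since
    (1 - x^2) u_m^2 <= E_n for all m >= n, it suffices to find n with
    E_n < (1 - x^2) u_k^2 and to check the few degrees below n. At the turn, E_k
    exceeds (1 - x^2) u_k^2 by at most (1 - x)^2 u_k^2, and this excess has to be
    dissipated. A Sturm comparison bounds 1 - x from above in terms of k
    ([kern_pos_bound]). If 3 <= k <= 12 b, two steps suffice ([energy_moderate]). If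
    k >= 12 b, damping is weak, but 1 - x is so small that the excess is used up
    about when the sequence has come back to half the depth of the turn
    ([energy_slow]). The cases k = 1 and k = 2 are the delicate ones: for alpha = 0
    and x = -1/3 the values at the degrees 1, 2 and 5 coincide, so the estimates
    must use alpha > 0 strictly; they come down to explicit polynomial
    inequalities ([first_turn], [second_turn]).

    It remains to identify the two polynomial families with the ones defined by
    orthogonality. The recurrence gives the differential equation of U_n
    ([gegen_ode]); integration of an exact derivative against the weight then makes
    the U_n orthogonal ([gegen_orthogonal]), K_n inherits orthogonality for the
    second weight from the difference formula ([kern_orthogonal]), and orthogonal
    families are unique up to scalars ([orthogonal_unique]). *)

(** * Ultraspherical polynomials and their Christoffel kernels *)

Section Gegenbauer.
Variable (R : realFieldType) (b : R).
Hypothesis b_gt0 : 0 < b.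

(** [gegen n] is the ultraspherical polynomial normalised by the value 1 at 1;
    [b] stands for 2 alpha + 1, which makes the recurrence rational in [b]. *)
Fixpoint gegen (n : nat) : {poly R} :=
  match n with
  | 0 => 1
  | n'.+1 => if n' is m.+1
      then (n'%:R + b)^-1 *: ((2 * n'%:R + b) *: ('X * gegen n') - n'%:R *: gegen m)
      else 'X
  end.

(** The Christoffel kernel at the point 1, up to a positive factor: a weighted sum
    of [gegen 0], ..., [gegen n], built one term at a time so that
    [gegen_diff] holds. *)
Fixpoint kern (n : nat) : {poly R} :=
  if n is m.+1
  then (n%:R + b)^-1 *: (n%:R *: kern m + (2 * n%:R + b) *: gegen n)
  else 1.

Lemma gegen_rec n x :
  (n.+1%:R + b) * (gegen n.+2).[x] =
  (2 * n.+1%:R + b) * x * (gegen n.+1).[x] - n.+1%:R * (gegen n).[x].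
Proof.
have h : n.+1%:R + b != 0 by rewrite gt_eqF// addr_gt0.
rewrite [gegen n.+2]/= -/(gegen n.+1) hornerZ hornerD hornerN !hornerZ hornerM hornerX
  mulVKf//; ring.
Qed.

Lemma kern_gegen n x :
  (n.+1%:R + b) * (kern n.+1).[x] =
  n.+1%:R * (kern n).[x] + (2 * n.+1%:R + b) * (gegen n.+1).[x].
Proof.
have h : n.+1%:R + b != 0 by rewrite gt_eqF// addr_gt0.
by rewrite [kern n.+1]/= -/(gegen n.+1) hornerZ hornerD !hornerZ mulVKf.
Qed.

(** The key link: the increments of the sequence of values are governed by the
    sign of [kern]. *)
Lemma gegen_diff n x : (gegen n).[x] - (gegen n.+1).[x] = (1 - x) * (kern n).[x].
Proof.
elim: n => [|n IH]; first by rewrite /= !hornerE.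
have h : n.+1%:R + b != 0 by rewrite gt_eqF// addr_gt0.
apply: (mulfI h).
rewrite mulrBr gegen_rec mulrCA kern_gegen.
have -> : (gegen n).[x] = (gegen n.+1).[x] + (1 - x) * (kern n).[x] by rewrite -IH; ring.
ring.
Qed.

(** Eliminating [gegen] between [kern_gegen] at two consecutive degrees; the
    denominators are cleared. *)
Lemma kern_rec n x :
  (n.+1%:R + b + 1) * (2 * n.+1%:R + b) * (kern n.+2).[x] =
  ((n.+2%:R) * (2 * n.+1%:R + b) + (n.+1%:R + b) * (2 * n.+1%:R + b + 2)
     - (1 - x) * (2 * n.+1%:R + b) * (2 * n.+1%:R + b + 2)) * (kern n.+1).[x]
  - n.+1%:R * (2 * n.+1%:R + b + 2) * (kern n).[x].
Proof.
have e1 := kern_gegen n.+1 x.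
have e2 := kern_gegen n x.
have e3 := gegen_diff n.+1 x.
have -> : n.+1%:R + b + 1 = n.+2%:R + b by rewrite -[n.+2]addn1 natrD; ring.
rewrite -mulrA mulrCA e1.
have -> : (gegen n.+2).[x] = (gegen n.+1).[x] - (1 - x) * (kern n.+1).[x].
  by rewrite -e3; ring.
move: e2; rewrite -[n.+2]addn1 natrD.
set N : R := n.+1%:R; set k0 := (kern n).[x]; set k1 := (kern n.+1).[x].
set g := (gegen n.+1).[x] => e2.
have -> : (2 * N + b) * ((N + 1%:R) * k1 + (2 * (N + 1%:R) + b) * (g - (1 - x) * k1))
  = (2 * N + b) * (N + 1) * k1 + (2 * N + b + 2) * ((2 * N + b) * g)
    - (2 * N + b) * (2 * N + b + 2) * (1 - x) * k1 by ring.
have -> : (2 * N + b) * g = (N + b) * k1 - N * k0 by rewrite e2; ring.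
ring.
Qed.

Lemma gegen_at1 n : (gegen n).[1] = 1.
Proof.
elim: n => [|n IH]; first by rewrite /= !hornerE.
by have := gegen_diff n 1; rewrite IH subrr mul0r => /subr0_eq.
Qed.

Lemma kern_at1 n : (kern n).[1] = (2 * n%:R + b + 1) / (b + 1).
Proof.
have hb : b + 1 != 0 by rewrite gt_eqF// addr_gt0.
elim: n => [|n IH]; first by rewrite /= hornerE mulr0 add0r divff.
have h : n.+1%:R + b != 0 by rewrite gt_eqF// addr_gt0.
apply: (mulfI h); rewrite kern_gegen gegen_at1 IH.
by rewrite -natr1; field.
Qed.

Lemma size_gegen_lt n : (size (gegen n) == n.+1) && (size (gegen n.+1) == n.+2).
Proof.
elim: n => [|n /andP[/eqP s0 /eqP s1]]; first by rewrite /= size_poly1 size_polyX.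
rewrite s1 eqxx /=; rewrite -/(gegen n.+1).
have h : n.+1%:R + b != 0 by rewrite gt_eqF// addr_gt0.
rewrite size_scale ?invr_eq0//.
have hh : (2 * n.+1%:R + b) != 0 by rewrite gt_eqF// addr_gt0// mulr_gt0.
have sX : size ((2 * n.+1%:R + b) *: ('X * gegen n.+1)) = n.+3.
  by rewrite size_scale// mulrC size_mulX ?s1 // -size_poly_eq0 s1.
rewrite size_polyDl sX// size_polyN.
by rewrite size_scale ?pnatr_eq0// s0.
Qed.

Lemma size_gegen n : size (gegen n) = n.+1.
Proof. by have /andP[/eqP] := size_gegen_lt n. Qed.

Lemma size_kern n : size (kern n) = n.+1.
Proof.
elim: n => [|n IH]; first by rewrite /= size_poly1.
have h : n.+1%:R + b != 0 by rewrite gt_eqF// addr_gt0.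
have hh : (2 * n.+1%:R + b) != 0 by rewrite gt_eqF// addr_gt0// mulr_gt0.
rewrite [kern n.+1]/= -/(gegen n.+1) size_scale ?invr_eq0// addrC.
by rewrite size_polyDl !size_scale ?pnatr_eq0// ?IH size_gegen.
Qed.
End Gegenbauer.

(** * Energy of a sequence of values, and Sturm comparison *)

Lemma one_sub_sqr_gt0 (R : realFieldType) (x : R) : -1 < x -> x < 1 -> 0 < 1 - x ^+ 2.
Proof.
move=> xN1 x1; have -> : 1 - x ^+ 2 = (1 - x) * (1 + x) by ring.
by apply: mulr_gt0; lra.
Qed.

Section Energy.
Variable (R : realFieldType) (b x : R).
Hypothesis b_gt0 : 0 < b.
Hypothesis x_gtN1 : -1 < x.
Hypothesis x_lt1 : x < 1.

Local Notation u n := (gegen b n).[x].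
Local Notation K n := (kern b n).[x].

(** For b = 0 this is the conserved quadratic form of the recurrence
    u (n + 2) = 2 x u (n + 1) - u n; it is symmetric in [u n] and [u n.+1]. *)
Definition energy n : R := (1 - x ^+ 2) * u n.+1 ^+ 2 + (u n - x * u n.+1) ^+ 2.

Let s n : R := n%:R / (n%:R + b).

(** Damping: the factor 1 - s^2 comes from b > 0 and is of order 2 b / n. *)
Lemma energyS n :
  energy n.+1 = energy n - (1 - s n.+1 ^+ 2) * (u n - x * u n.+1) ^+ 2.
Proof.
have h : n.+1%:R + b != 0 by rewrite gt_eqF// addr_gt0.
rewrite /energy /s; have e := gegen_rec b_gt0 n x.
have -> : u n.+2 = ((2 * n.+1%:R + b) * x * u n.+1 - n.+1%:R * u n) / (n.+1%:R + b).
  by rewrite -e mulrAC mulfV// mul1r.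
by move: h; move: (n.+1%:R : R) => t h; field.
Qed.

Lemma frac_lt1 n : 0 <= s n < 1.
Proof.
have h : 0 < n%:R + b by rewrite ltr_wpDl// ler0n.
by rewrite /s divr_ge0 ?ler0n ?(ltW h)//= ltr_pdivrMr// mul1r ltrDl.
Qed.

Lemma energy_decr n : energy n.+1 <= energy n.
Proof.
rewrite energyS lerBlDr lerDl mulr_ge0// ?sqr_ge0//.
have := frac_lt1 n.+1; nra.
Qed.

Lemma energy_homo m n : (m <= n)%N -> energy n <= energy m.
Proof.
move=> /subnK <-; elim: (n - m)%N => [|d IH]; first by rewrite add0n.
by apply: le_trans IH; rewrite addSn energy_decr.
Qed.

(** The energy bounds every later value, so one drop of the energy below the
    level of a negative value [u k] settles all the later degrees at once. *)
Lemma gegen_gt_of_energy k n m :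
  u k < 0 -> energy n < (1 - x ^+ 2) * u k ^+ 2 -> (n <= m)%N -> u k < u m.
Proof.
move=> uk en nm.
have q := one_sub_sqr_gt0 x_gtN1 x_lt1.
have : (1 - x ^+ 2) * u m ^+ 2 < (1 - x ^+ 2) * u k ^+ 2.
  apply: le_lt_trans en; apply: le_trans (energy_homo nm).
  rewrite /energy; have -> : (1 - x ^+ 2) * u m.+1 ^+ 2 + (u m - x * u m.+1) ^+ 2 =
    (1 - x ^+ 2) * u m ^+ 2 + (u m.+1 - x * u m) ^+ 2 by ring.
  by rewrite lerDl sqr_ge0.
rewrite ltr_pM2l// => h; rewrite ltNge; apply/negP => h2; nra.
Qed.

End Energy.

Section Sturm.
Variable (R : realFieldType) (b x : R).
Hypothesis b_gt0 : 0 < b.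
Local Notation K n := (kern b n).[x].

Let N (t : R) := t * (t + b + 1).

(** Sturm comparison. A sequence [g] with [g 0], ..., [g k] positive and
    [g k.+1] = 0 that satisfies the recurrence of [kern] as an inequality lies
    above it in ratio, which would force [kern k.+1] to be nonpositive at x.
    In terms of N = n (n + b + 1), on which the recurrence operator acts like a
    derivative, [g] is (2 n + b + 1) times a quadratic in N; the second factor of
    that quadratic is chosen so that the defect of [g] also vanishes at k + 1. *)
Lemma kern_pos_bound k : (forall j, (j <= k.+1)%N -> 0 < K j) ->
  (1 - x) * ((k.+2%:R + b) * (2 * k.+2%:R + b + 1)) < (b + 3) * (b + 5).
Proof.
move=> Kpos; have b0 := b_gt0; rewrite ltNge; apply/negP => hq.
set M := N k.+1%:R.
pose g (t : R) := (2 * t + b + 1) * (M - N t) * ((b + 7) * M + (b + 2) * (b + 3) - (b +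
  3) * N t).
have nat0 n : 0 <= n%:R :> R by rewrite ler0n.
have Nmono (i j : nat) : (i <= j)%N -> N i%:R <= N j%:R.
  rewrite -(ler_nat R) /N => ij; have := nat0 i; have := nat0 j; nra.
(* The error made by g in the recurrence, compared with (1 - x) g. *)
have defect n : (n <= k)%N ->
  2 * (b + 3) * (b + 5) * (2 * n%:R + b + 1) * (M - N n%:R) <= (1 - x) * g n%:R.
  move=> nk; have -> : (1 - x) * g n%:R = ((2 * n%:R + b + 1) * (M - N n%:R)) *
     ((1 - x) * ((b + 7) * M + (b + 2) * (b + 3) - (b + 3) * N n%:R)) by rewrite /g; ring.
  have -> : 2 * (b + 3) * (b + 5) * (2 * n%:R + b + 1) * (M - N n%:R) =
     ((2 * n%:R + b + 1) * (M - N n%:R)) * (2 * (b + 3) * (b + 5)) by ring.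
  have MN : N n%:R <= M by apply: Nmono; apply: leqW.
  apply: ler_wpM2l.
    by apply: mulr_ge0; [have := nat0 n; lra|rewrite subr_ge0].
  have x1 : 0 <= 1 - x.
    rewrite leNgt; apply/negP => x1.
    have : 0 < (k.+2%:R + b) * (2 * k.+2%:R + b + 1) by have := nat0 k.+2; nra.
    nra.
  apply: (@le_trans _ _ ((1 - x) * ((b + 7) * M + (b + 2) * (b + 3) - (b +
    3) * N k%:R))); last first.
    apply: ler_wpM2l => //; have := Nmono _ _ nk; nra.
  have -> : (b + 7) * M + (b + 2) * (b + 3) - (b + 3) * N k%:R =
     2 * ((k.+2%:R + b) * (2 * k.+2%:R + b + 1)).
    rewrite /M /N -[k.+2]addn2 -[k.+1]addn1 !natrD; ring.
  lra.
have gpos n : (n <= k)%N -> 0 < g n%:R.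
  move=> nk.
  have MN : N n%:R < M.
    by apply: le_lt_trans (Nmono _ _ nk) _; rewrite /M /N -natr1; have := nat0 k; nra.
  have N0 : 0 <= N n%:R by rewrite /N; have := nat0 n; nra.
  rewrite /g; apply: mulr_gt0.
    by apply: mulr_gt0; [have := nat0 n; lra|rewrite subr_gt0].
  nra.
have g_end : g k.+1%:R = 0 by rewrite /g /M subrr; ring.
have comp n : (n <= k)%N -> K n.+1 * g n%:R <= K n * g n.+1%:R.
  elim: n => [_|n IH nk].
    have hb : 0 < b + 1 by lra.
    have e1 : (b + 1) * K 1%N = 1 + (b + 2) * x.
      have := kern_gegen b_gt0 0 x; rewrite [gegen b 1]/= [kern b 0]/= hornerX hornerC => e.
      by rewrite addrC e; ring.
    have d0 := defect 0%N isT.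
    rewrite -(ler_pM2l hb) mulrA e1 [kern b 0]/= hornerC mul1r.
    have -> : (b + 1) * g 1 =
      (1 + (b + 2) * x) * g 0 + (b + 2) * ((1 - x) * g 0 - 2 * (b + 3) * (b + 5) * (2 * 0 +
        b + 1) * (M - N 0)).
      by rewrite /g /N; ring.
    rewrite lerDl; apply: mulr_ge0; first lra.
    by rewrite subr_ge0.
  have {}IH := IH (ltnW nk).
  set m : R := n.+1%:R.
  have m0 : 0 < m by rewrite ltr0n.
  have hA : 0 < (m + b + 1) * (2 * m + b) by nra.
  rewrite -(ler_pM2l hA).
  have -> : (m + b + 1) * (2 * m + b) * (K n.+2 * g m) =
     ((m + b + 1) * (2 * m + b) * K n.+2) * g m by ring.
  rewrite /m kern_rec// -/m.
  have en : n%:R = m - 1 by rewrite /m -natr1; ring.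
  have en2 : n.+2%:R = m + 1 by rewrite /m -[n.+2]addn1 natrD.
  have -> : (m + b + 1) * (2 * m + b) * (K n.+1 * g n.+2%:R) =
    K n.+1 * ((((m + 1) * (2 * m + b) + (m + b) * (2 * m + b + 2)
     - (1 - x) * (2 * m + b) * (2 * m + b + 2)) * g m - m * (2 * m + b + 2) * g n%:R)
     + (2 * m + b) * (2 * m + b + 2) * ((1 - x) * g m - 2 * (b + 3) * (b + 5) * (2 * m + b +
       1) * (M - N m))).
    by rewrite en en2 /g /N; ring.
  have d1 := defect _ nk; rewrite -/m in d1.
  have K1 : 0 < K n.+1 by apply: Kpos; apply: leqW.
  rewrite en2 -subr_ge0.
  have -> : forall k0 k1 g0 g1 d c1 c2 : R, k1 * ((c1 * g1 - m * (2 * m + b + 2) * g0) + c2 * d)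
     - (c1 * k1 - m * (2 * m + b + 2) * k0) * g1
     = m * (2 * m + b + 2) * (k0 * g1 - k1 * g0) + c2 * (k1 * d) by move=> *; ring.
  apply: addr_ge0.
    by apply: mulr_ge0; [nra|rewrite subr_ge0].
  apply: mulr_ge0; first nra.
  by apply: mulr_ge0; [exact: ltW|rewrite subr_ge0].
have := comp k (leqnn k); rewrite g_end mulr0 leNgt => /negP; apply.
by apply: mulr_gt0; [exact: Kpos|exact: gpos].
Qed.
End Sturm.

(** * Polynomial inequalities *)

(** Linear arithmetic treats monomials as atoms, so a polynomial is shown to be
    positive by supplying as hypotheses all the products of nonnegative
    quantities in a range of degrees; [iter_lt] runs through such a range. *)
Ltac iter_lt n tac :=
  lazymatch n with O => idtac | S ?m => iter_lt m tac; tac m end.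

Section PolynomialInequalities.
Variable R : realFieldType.
Implicit Types b c j k x : R.

(** In c and j only the coefficients of j^6, j^7 and j^8 of the difference are
    negative, and they are absorbed by j <= 9 + 12 c. *)
Lemma poly_moderate c j : 0 <= c -> 0 <= j -> j <= 9 + 12 * c ->
  let k := 3 + j in let B := 1 + c in
  let D := (k + B) * (2 * k + B + 1) in let N := (B + 3) * (B + 5) in
  (k + 1) ^+ 2 * (k + 2 + B) ^+ 2 * D ^+ 2 <
  B * (2 * (k + 2) + B) * ((k + 1 + B) * D + (2 * k + 2 + B) * (D - N)) ^+ 2.
Proof.
move=> c0 j0 jle; cbv zeta; rewrite -subr_gt0.
have w0 : 0 <= 9 + 12 * c - j by rewrite subr_ge0.
have m p q : 0 <= c ^+ p * j ^+ q by apply: mulr_ge0; apply: exprn_ge0.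
have mw q : 0 <= (9 + 12 * c - j) * j ^+ q by apply: mulr_ge0 => //; apply: exprn_ge0.
iter_lt 8%N ltac:(fun q => move: (mw q)).
iter_lt 9%N ltac:(fun p => iter_lt 8%N ltac:(fun q => move: (m p q))).
lra.
Qed.

(** With s1 = (k + 1) / (k + 1 + b) and s2 = (k + 2) / (k + 2 + b) the conclusion
    says s1^2 < (1 - s2^2) (1 + (1 + s1) x)^2. Its right-hand side increases with
    x, so only the smallest x allowed by the Sturm bound matters. *)
Lemma ineq_moderate b k x : 1 <= b -> 3 <= k -> k <= 12 * b -> x < 1 ->
  (1 - x) * ((k + b) * (2 * k + b + 1)) <= (b + 3) * (b + 5) ->
  0 < x /\ (k + 1) ^+ 2 * (k + 2 + b) ^+ 2 <
  b * (2 * (k + 2) + b) * ((k + 1 + b) + (2 * k + 2 + b) * x) ^+ 2.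
Proof.
move=> b1 k3 kb x1 hx.
have := @poly_moderate (b - 1) (k - 3).
have -> : 3 + (k - 3) = k by ring.
have -> : 1 + (b - 1) = b by ring.
set D := (k + b) * _ in hx *; set N := (b + 3) * _ in hx *.
move=> /(_ _ _ _)/wrap[]; [lra|lra|lra|] => H.
have D0 : 0 < D by rewrite /D; apply: mulr_gt0; lra.
have DN : 0 < D - N by rewrite /D /N; nra.
have xD : D - N <= D * x by lra.
split; first by rewrite -(pmulr_rgt0 _ D0); lra.
rewrite -(ltr_pM2r (exprn_gt0 2 D0)); apply: lt_le_trans H _.
rewrite -[leRHS]mulrA -exprMn; apply: ler_wpM2l; first by apply: mulr_ge0; lra.
rewrite ler_sqr ?nnegrE.
- have -> : (k + 1 + b + (2 * k + 2 + b) * x) * D =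
  (k + 1 + b) * D + (2 * k + 2 + b) * (D * x) by ring.
  by rewrite lerD2l; apply: ler_wpM2l; [lra|].
- by apply: addr_ge0; apply: mulr_ge0; [lra|exact: ltW|lra|exact: ltW].
- have x0 : 0 < x by rewrite -(pmulr_rgt0 _ D0); lra.
  by apply: mulr_ge0; [apply: addr_ge0; [lra|apply: mulr_ge0; [lra|exact: ltW]]|exact: ltW].
Qed.
(** Put S = 1 - 2 y - (c + 5) y^2. The substitution y = 1 / (1 + r) turns S / y^2
    into r^2 - 6 - c, and reducing the even powers of r in the difference
    leaves only nonnegative coefficients; hence the difference is a nonnegative
    combination of the products c^p (1 - y)^q S^r y^(8 - q - 2 r). *)
Lemma poly_second_turn (c y : R) : 0 <= c -> 0 <= y -> (c + 5) * y ^+ 2 + 2 * y - 1 <= 0 ->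
  let b := 1 + c in let Y := y ^+ 2 in
  ((b + 4) * (b + 6) * Y ^+ 2 - 6 * (b + 4) * Y + 3) ^+ 2 + 16 * Y * (1 - Y) * ((b +
    6) * Y - 3) ^+ 2
  < (b + 3) ^+ 2 * (1 - (b + 2) * Y) ^+ 2.
Proof.
move=> c0 y0 hS; cbv zeta.
have S0 : 0 <= 1 - 2 * y - (c + 5) * y ^+ 2 by lra.
have y1 : 0 <= 1 - y by nra.
have m p q r s : 0 <= c ^+ p * ((1 - y) ^+ q * ((1 - 2 * y - (c + 5) * y ^+ 2) ^+ r * y ^+ s)).
  by do 3?[apply: mulr_ge0]; apply: exprn_ge0.
have [y00|yn0] := eqVneq y 0.
  by rewrite y00; nra.
have y8 : 0 < y ^+ 8 by rewrite exprn_gt0// lt_neqAle eq_sym yn0.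
iter_lt 6%N ltac:(fun p =>
  move: (m p 0%N 0%N 8%N) (m p 0%N 1%N 6%N) (m p 0%N 2%N 4%N) (m p 0%N 3%N 2%N)
    (m p 0%N 4%N 0%N) (m p 1%N 0%N 7%N) (m p 1%N 1%N 5%N) (m p 1%N 2%N 3%N)
    (m p 1%N 3%N 1%N)).
lra.
Qed.
(** The difference has nonnegative coefficients in the Bernstein basis of
    the interval from 0 to 1 / (c + 3). *)
Lemma poly_fifth (c y : R) : 0 <= c -> 0 <= y -> 0 < 1 - (c + 3) * y ->
  let b := 1 + c in let Y := y ^+ 2 in
  y * ((b + 6) * (b + 8) * Y ^+ 2 - 10 * (b + 6) * Y + 15) < (b + 3) * (1 - (b + 2) * Y).
Proof.
move=> c0 y0 hZ; cbv zeta.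
have m p r s : 0 <= c ^+ p * (y ^+ r * (1 - (c + 3) * y) ^+ s).
  by do 2?[apply: mulr_ge0]; apply: exprn_ge0 => //; exact: ltW.
have z5 : 0 < (1 - (c + 3) * y) ^+ 5 by apply: exprn_gt0.
iter_lt 7%N ltac:(fun p => iter_lt 6%N ltac:(fun r => move: (m p r (5 - r)%N))).
lra.
Qed.
(** The margin is about one per cent at c = 0, Y = 1 / 5; products containing the
    slack 1 - (c + 1) (c + 5) Y up to the third power are needed. *)
Lemma poly_sixth (c Y : R) : 0 <= c -> 0 <= Y -> (c + 1) * (c + 5) * Y <= 1 ->
  let b := 1 + c in
  (b + 2) ^+ 2 * (((b + 6) * (b + 8) * (b + 10) * Y ^+ 3 - 15 * (b + 6) * (b + 8) * Y ^+ 2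
     + 45 * (b + 6) * Y - 15) ^+ 2
    + (1 - Y) * Y * (6 * ((b + 8) * (b + 10) * Y ^+ 2 - 10 * (b + 8) * Y + 15)) ^+ 2)
  < ((b + 1) * (b + 3) * (b + 5)) ^+ 2.
Proof.
move=> c0 Y0 hZ; cbv zeta.
have Z0 : 0 <= 1 - (c + 1) * (c + 5) * Y by lra.
have m p r s : 0 <= c ^+ p * (Y ^+ r * (1 - (c + 1) * (c + 5) * Y) ^+ s).
  by do 2?[apply: mulr_ge0]; apply: exprn_ge0.
iter_lt 9%N ltac:(fun p => iter_lt 7%N ltac:(fun r => move: (m p r 0%N))).
iter_lt 9%N ltac:(fun p => iter_lt 4%N ltac:(fun r =>
  move: (m p r 1%N) (m p r 2%N) (m p r 3%N))).
lra.
Qed.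
End PolynomialInequalities.

(** * Turns of moderate degree *)

Section Moderate.
Variable R : realFieldType.

(** The difference of the two sides is a concave quadratic in t, so it suffices
    to look at the ends of the range of t. The end t = 0 is the hypothesis; the
    other end, where the value at the turn equals the one before it, is the same
    inequality for the preceding index, with (s, s1) in place of (s1, s2),
    and is weaker. *)
Lemma two_step_dissipation (x s s1 s2 t : R) :
  0 < x -> x < 1 -> 0 <= s -> s <= s1 -> s1 <= s2 -> s2 < 1 -> 0 < s1 ->
  s1 ^+ 2 < (1 - s2 ^+ 2) * (1 + (1 + s1) * x) ^+ 2 ->
  0 <= t -> t <= (1 + s) * (1 - x) ->
  (t - (1 - x)) ^+ 2 < (1 - s1 ^+ 2) * (1 - x + x * t) ^+ 2 +
    (1 - s2 ^+ 2) * ((1 - x ^+ 2) * (1 - t) + s1 * x * (1 - x + x * t)) ^+ 2.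
Proof.
move=> x0 x1 sge0 ss1 s12 s2lt s1gt H0 t0 tle; rewrite -subr_gt0.
pose H y := (1 - s1 ^+ 2) * (1 - x + x * y) ^+ 2 +
    (1 - s2 ^+ 2) * ((1 - x ^+ 2) * (1 - y) + s1 * x * (1 - x + x * y)) ^+ 2
    - (y - (1 - x)) ^+ 2.
rewrite -/(H t).
set t1 := (1 + s) * (1 - x) in tle.
have q0 : 0 < 1 - x by lra.
have t1gt : 0 < t1 by apply: mulr_gt0; lra.
have c1 : 0 < 1 - s1 ^+ 2 by nra.
have c2 : 0 < 1 - s2 ^+ 2 by nra.
have c12 : 1 - s2 ^+ 2 <= 1 - s1 ^+ 2 by nra.
have Hat0 : 0 < H 0.
  have -> : H 0 = (1 - x) ^+ 2 * ((1 - s2 ^+ 2) * (1 + (1 + s1) * x) ^+ 2 - s1 ^+ 2).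
    by rewrite /H; ring.
  by apply: mulr_gt0; [apply: exprn_gt0|rewrite subr_gt0].
have Hat1 : 0 < H t1.
  have k1 : s ^+ 2 < (1 - s1 ^+ 2) * (1 + (1 + s) * x) ^+ 2.
    have s1sq : 0 < s1 ^+ 2 by apply: exprn_gt0.
    rewrite -(ltr_pM2l s1sq).
    have a1 : (s * (1 + (1 + s1) * x)) ^+ 2 <= (s1 * (1 + (1 + s) * x)) ^+ 2.
      rewrite ler_sqr ?nnegrE; first nra.
      - by apply: mulr_ge0 => //; nra.
      - by apply: mulr_ge0; nra.
    have a2 : s1 ^+ 2 * ((1 - s1 ^+ 2) * (1 + (1 + s) * x) ^+ 2) =
      (1 - s1 ^+ 2) * (s1 * (1 + (1 + s) * x)) ^+ 2 by ring.
    case: (ltrgt0P s) sge0 => // [sgt0 _|-> _]; last first.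
      rewrite expr0n /= mulr0; apply: mulr_gt0 => //; apply: mulr_gt0 => //.
      by apply: exprn_gt0; nra.
    rewrite a2; apply: lt_le_trans (ler_wpM2l (ltW c1) a1).
    apply: lt_le_trans (ler_wpM2r (sqr_ge0 _) c12).
    have -> : s1 ^+ 2 * s ^+ 2 = s ^+ 2 * s1 ^+ 2 by ring.
    have -> : (1 - s2 ^+ 2) * (s * (1 + (1 + s1) * x)) ^+ 2 =
      s ^+ 2 * ((1 - s2 ^+ 2) * (1 + (1 + s1) * x) ^+ 2) by ring.
    by rewrite ltr_pM2l// exprn_gt0.
  have -> : H t1 = (1 - x) ^+ 2 * ((1 - s1 ^+ 2) * (1 + (1 + s) * x) ^+ 2 - s ^+ 2)
      + (1 - s2 ^+ 2) * ((1 - x ^+ 2) * (1 - t1) + s1 * x * (1 - x + x * t1)) ^+ 2.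
    by rewrite /H /t1; ring.
  apply: ltr_wpDr; first by apply: mulr_ge0; [exact: ltW|exact: sqr_ge0].
  by apply: mulr_gt0; [apply: exprn_gt0|rewrite subr_gt0].
(* The leading coefficient of H, which is convex in x^2. *)
have h2 : (1 - s1 ^+ 2) * x ^+ 2 + (1 - s2 ^+ 2) * (s1 * x ^+ 2 - (1 - x ^+ 2)) ^+ 2 - 1 <= 0.
  have y0 : 0 <= x ^+ 2 by apply: sqr_ge0.
  have y1 : x ^+ 2 <= 1 by nra.
  move: y0 y1; move: (x ^+ 2) => y y0 y1.
  have sq : (s1 * y - (1 - y)) ^+ 2 <= s1 ^+ 2 * y + (1 - y).
    rewrite -subr_ge0.
    have -> : s1 ^+ 2 * y + (1 - y) - (s1 * y - (1 - y)) ^+ 2 =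
      (1 + s1) ^+ 2 * (y * (1 - y)) by ring.
    by apply: mulr_ge0; [exact: sqr_ge0|apply: mulr_ge0; lra].
  have : (1 - s2 ^+ 2) * (s1 * y - (1 - y)) ^+ 2 <= s1 ^+ 2 * y + (1 - y).
    apply: le_trans sq; have := sqr_ge0 (s1 * y - (1 - y)); have := sqr_ge0 s2.
    by move: (_ ^+ 2) => ?; move: (_ ^+ 2) => ? ? ?; nra.
  lra.
have conc : t1 * H t - ((t1 - t) * H 0 + t * H t1) =
   - ((1 - s1 ^+ 2) * x ^+ 2 +
     (1 - s2 ^+ 2) * (s1 * x ^+ 2 - (1 - x ^+ 2)) ^+ 2 - 1) * (t1 * (t * (t1 - t))).
  by rewrite /H; ring.
rewrite -(pmulr_rgt0 _ t1gt).
apply: (@lt_le_trans _ _ ((t1 - t) * H 0 + t * H t1)).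
  have [->|tn0] := eqVneq t 0; first by rewrite mul0r addr0 subr0 mulr_gt0.
  have tgt : 0 < t by rewrite lt_neqAle eq_sym tn0.
  apply: ltr_wpDl; last by apply: mulr_gt0.
  by apply: mulr_ge0; [rewrite subr_ge0|exact: ltW].
rewrite -subr_ge0 conc; apply: mulr_ge0; first by rewrite oppr_ge0.
by apply: mulr_ge0; [exact: ltW|apply: mulr_ge0 => //; rewrite subr_ge0].
Qed.

End Moderate.

Section ModerateEnergy.
Variable (R : realFieldType) (b x : R).
Local Notation u n := (gegen b n).[x].

(** The first step after the turn, relative to the value at the turn, is less than
    (1 + s) (1 - x): substitute u n > u n.+1 in the recurrence. *)
Lemma turn_drop n (b0 : 0 < b) : u n.+1 < 0 -> u n.+1 <= u n.+2 -> u n.+1 < u n ->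
  exists2 t, u n.+2 = u n.+1 * (1 - t) & 0 <= t /\ t < (1 + n.+1%:R / (n.+1%:R + b)) * (1 - x).
Proof.
move=> un le1 lt1; have un0 : u n.+1 != 0 by rewrite lt_eqF.
exists (1 - u n.+2 / u n.+1); first by rewrite subKr mulrCA mulfV// mulr1.
split; first by rewrite subr_ge0 ler_ndivrMr// mul1r.
have h : 0 < n.+1%:R + b by rewrite addr_gt0.
have -> : (1 + n.+1%:R / (n.+1%:R + b)) * (1 - x) =
  ((2 * n.+1%:R + b) * (1 - x)) / (n.+1%:R + b).
  by move: (n.+1%:R : R) h => k h; field; rewrite gt_eqF.
rewrite ltr_pdivlMr// -(ltr_nM2l un).
have e := gegen_rec b0 n x.
have -> : u n.+1 * ((1 - u n.+2 / u n.+1) * (n.+1%:R + b)) =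
  (u n.+1) * (n.+1%:R + b) - ((n.+1%:R + b) * u n.+2).
  by move: (n.+1%:R : R) => k; field.
rewrite e -subr_gt0.
set k : R := n.+1%:R; have k0 : 0 < k by rewrite ltr0n.
have -> : u n.+1 * (k + b) - ((2 * k + b) * x * u n.+1 - k * u n) - u n.+1 * ((2 * k +
  b) * (1 - x)) = k * (u n - u n.+1) by ring.
by rewrite mulr_gt0// subr_gt0.
Qed.

(** The energy at the turn exceeds the target (1 - x^2) u^2 by (t - (1 - x))^2 u^2,
    which the first two steps dissipate. *)
Lemma energy_moderate n : 1 <= b -> n.+3%:R <= 12 * b -> x < 1 ->
  (1 - x) * ((n.+3%:R + b) * (2 * n.+3%:R + b + 1)) <= (b + 3) * (b + 5) ->
  u n.+3 < 0 -> u n.+3 < u n.+2 -> u n.+3 <= u n.+4 ->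
  energy b x n.+3.+2 < (1 - x ^+ 2) * u n.+3 ^+ 2.
Proof.
move=> b1 kb x1 hx un lt1 le1; have b0 : 0 < b by lra.
have [t et [t0 tlt]] := turn_drop b0 un le1 lt1.
have k3 : 3 <= n.+3%:R :> R by rewrite ler_nat.
have [x0 ineq] := ineq_moderate b1 k3 kb x1 hx.
rewrite (@energyS _ b x b0 n.+4) (@energyS _ b x b0 n.+3).
have e := gegen_rec b0 n.+3 x.
have k1E : n.+4%:R = n.+3%:R + 1 :> R by rewrite -natr1.
have k2E : n.+3.+2%:R = n.+3%:R + 2 :> R by rewrite -addn2 natrD.
move: e; rewrite k1E k2E.
set k : R := n.+3%:R in k3 ineq tlt kb hx *; set a := u n.+3 in un le1 lt1 et * => e.
set s := k / (k + b) in tlt; set s1 := (k + 1) / (k + 1 + b); set s2 := (k + 2) / (k + 2 + b).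
have s1gt : 0 < s1 by rewrite divr_gt0//; lra.
have sge : 0 <= s by rewrite divr_ge0//; lra.
have ss1 : s <= s1.
  by rewrite /s /s1 ler_pdivrMr; [rewrite mulrAC ler_pdivlMr; [nra|lra]|lra].
have s12 : s1 <= s2.
  by rewrite /s1 /s2 ler_pdivrMr; [rewrite mulrAC ler_pdivlMr; [nra|lra]|lra].
have s21 : s2 < 1 by rewrite ltr_pdivrMr; lra.
have e2 : u n.+3.+2 = a * (x * (1 - t) - s1 * (1 - x * (1 - t))).
  rewrite -[LHS](mulKf (lt0r_neq0 _ : k + 1 + b != 0)); last by lra.
  rewrite e et /s1; field; rewrite gt_eqF//; lra.
have -> : energy b x n.+3 = a ^+ 2 * ((1 - x ^+ 2) + (t - (1 - x)) ^+ 2).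
  by rewrite /energy et -/a; ring.
rewrite e2 et.
have I : s1 ^+ 2 < (1 - s2 ^+ 2) * (1 + (1 + s1) * x) ^+ 2.
  have hh1 : 0 < k + 1 + b by lra.
  have hh2 : 0 < k + 2 + b by lra.
  have -> : s1 ^+ 2 = ((k + 1) ^+ 2 * (k + 2 + b) ^+ 2) / ((k + 1 + b) * (k + 2 + b)) ^+ 2.
    by rewrite /s1; clearbody k; field; do ?[apply/andP; split]; exact: lt0r_neq0.
  have -> : (1 - s2 ^+ 2) * (1 + (1 + s1) * x) ^+ 2 =
    (b * (2 * (k + 2) + b) * ((k + 1 + b) + (2 * k + 2 + b) * x) ^+ 2) / ((k + 1 + b) * (k +
      2 + b)) ^+ 2.
    by rewrite /s1 /s2; clearbody k; field; do ?[apply/andP; split]; exact: lt0r_neq0.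
  by rewrite ltr_pM2r// invr_gt0 exprn_gt0// mulr_gt0.
have := two_step_dissipation x0 x1 sge ss1 s12 s21 s1gt I t0 (ltW tlt).
rewrite -(ltr_pM2l (_ : 0 < a ^+ 2)); last by rewrite exprn_even_gt0//= lt_eqF.
by rewrite -subr_gt0 => H; rewrite -subr_gt0; move: H; congr (0 < _); ring.
Qed.
End ModerateEnergy.

(** * Turns of large degree *)

Section Slow.
Variable R : realFieldType.

(** The slowest start is t = 0, where the right-hand side is at least
    (7 / 4 + 3 / 5) (1 - x). *)
Lemma velocity_start (x s t : R) : 3 / 4 <= x -> x < 1 -> 4 / 5 <= s ->
  0 <= t -> t <= 2 * (1 - x) ->
  3 / 2 * (1 - x) <= (1 - x ^+ 2) * (1 - t) + s * x * (1 - x * (1 - t)).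
Proof.
move=> x34 x1 s45 t0 tle.
have sx : 3 / 5 <= s * x.
  by apply: (@le_trans _ _ (4 / 5 * (3 / 4))); [lra|apply: ler_pM => //; lra].
have xt : 3 / 4 * t <= x * t by apply: ler_wpM2r.
have h2 : 3 / 5 * (1 - x + x * t) <= s * x * (1 - x * (1 - t)).
  by apply: ler_pM => //; lra.
have h3 : (1 - x ^+ 2) * t <= 1 / 2 * t.
  apply: ler_wpM2r => //; have : 0 <= (x - 3 / 4) * (x + 3 / 4) by apply: mulr_ge0; lra.
  lra.
have h4 : 0 <= (1 - x) * (x - 3 / 4) by apply: mulr_ge0; lra.
lra.
Qed.

Lemma velocity_step (x s p z : R) : 3 / 4 <= x -> x < 1 -> 4 / 5 <= s ->
  1 / 2 <= p -> 3 / 2 * (1 - x) <= z ->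
  3 / 2 * (1 - x) <= (1 - x ^+ 2) * p + s * x * z.
Proof.
move=> x34 x1 s45 p12 zq.
have sx : 3 / 5 <= s * x.
  by apply: (@le_trans _ _ (4 / 5 * (3 / 4))); [lra|apply: ler_pM => //; lra].
have h1 : 0 <= (1 - x) * (1 + x) * (p - 1 / 2) by do 2?[apply: mulr_ge0]; lra.
have h2 : 3 / 5 * (3 / 2 * (1 - x)) <= s * x * z by apply: ler_pM => //; lra.
have h4 : 0 <= (1 - x) * (x - 3 / 4) by apply: mulr_ge0; lra.
lra.
Qed.

Lemma velocity_crossing (x p1 p2 : R) : 3 / 4 <= x -> x < 1 -> 1 / 2 <= p1 -> p2 < 1 / 2 ->
  1 - x ^+ 2 <= (1 - x ^+ 2) * p2 ^+ 2 + (p1 - x * p2) ^+ 2 ->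
  3 / 4 * (1 - x ^+ 2) <= (p1 - x * p2) ^+ 2.
Proof.
move=> x34 x1 p1ge p2lt; have [neg|pos] := ltP p2 (- (1 / 2)) => he.
  have xp : 0 <= x * (- (1 / 2) - p2) by apply: mulr_ge0; lra.
  have : 0 <= (p1 - x * p2 - (1 + x) / 2) * (p1 - x * p2 + (1 + x) / 2).
    by apply: mulr_ge0; lra.
  have : 0 <= (1 + x) * (x - 1 / 2) by apply: mulr_ge0; lra.
  lra.
have : 0 <= (1 - x) * (1 + x) * ((1 / 2 - p2) * (1 / 2 + p2)).
  by do 2?[apply: mulr_ge0]; lra.
lra.
Qed.

(** Here p is the sequence from the turn on, divided by its value at the turn,
    and z j = p j - x p j.+1 plays the part of a velocity. The excess of the
    energy over 1 - x^2 is at most (1 - x)^2 at the start. As long as p stays above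
    1 / 2, the velocity is at least (3 / 2) (1 - x) from the second step on, and each
    step dissipates at least d times its square; this cannot go on for J steps
    without using up the excess. At the first step where p falls below 1 / 2, most
    of the energy is kinetic, and that single step dissipates
    d (3 / 4) (1 - x^2) > (1 - x)^2. *)
Lemma slow_dissipation (x d t : R) (s p : nat -> R) (J : nat) :
  3 / 4 <= x -> x < 1 -> 0 <= t -> t <= 2 * (1 - x) ->
  p 0%N = 1 -> p 1%N = 1 - t ->
  (forall j, p j.+2 = x * p j.+1 - s j * (p j - x * p j.+1)) ->
  (forall j, 4 / 5 <= s j) ->
  (forall j, s j < 1) ->
  (forall j, (j <= J.+1)%N -> d <= 1 - s j ^+ 2) ->
  0 < d -> 1 < J%:R * d * (9 / 4) -> 1 - x < d * (3 / 4) * (1 + x) ->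
  let e j := (1 - x ^+ 2) * p j.+1 ^+ 2 + (p j - x * p j.+1) ^+ 2 in
  exists2 i, e i < 1 - x ^+ 2 & forall l, (2 <= l <= i)%N -> p l < 1.
Proof.
move=> xge x1 t0 tle p0 p1 prec sge slt dle d0 Jbig dq e.
have eE j : e j = (1 - x ^+ 2) * p j.+1 ^+ 2 + (p j - x * p j.+1) ^+ 2 by [].
pose z j := p j - x * p j.+1.
have zE j : z j = p j - x * p j.+1 by [].
pose q := 1 - x; have qE : q = 1 - x by [].
rewrite -qE in tle dq.
clearbody e z q.
have xt0 : 0 <= x * t by apply: mulr_ge0 => //; lra.
have q0 : 0 < q by rewrite qE; lra.
have q4 : q <= 1 / 4 by rewrite qE; lra.
have xxE : 1 - x ^+ 2 = q * (1 + x) by rewrite qE; ring.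
have xx : 0 < 1 - x ^+ 2 by rewrite xxE; apply: mulr_gt0; lra.
have zrec j : z j.+1 = (1 - x ^+ 2) * p j.+1 + s j * x * z j.
  by rewrite !zE prec; ring.
have erec j : e j.+1 = e j - (1 - s j ^+ 2) * z j ^+ 2.
  by rewrite !eE zE prec; ring.
have sq2 j : 0 <= 1 - s j ^+ 2.
  have -> : 1 - s j ^+ 2 = (1 - s j) * (1 + s j) by ring.
  by have := sge j; have := slt j => ? ?; apply: mulr_ge0; lra.
have edec j : e j.+1 <= e j by rewrite erec lerBlDr lerDl mulr_ge0// sqr_ge0.
have e0 : e 0%N <= 1 - x ^+ 2 + q ^+ 2.
  have -> : e 0%N = 1 - x ^+ 2 + (t - q) ^+ 2 by rewrite eE p0 p1 qE; ring.
  have : 0 <= t * (2 * q - t) by apply: mulr_ge0 => //; lra.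
  by rewrite lerD2l; lra.
have eJ j : e j <= 1 - x ^+ 2 + q ^+ 2.
  by elim: j => // j IH; apply: le_trans IH.
suff claim j : (j <= J.+1)%N ->
  (exists2 i, e i < 1 - x ^+ 2 & forall l, (2 <= l <= i)%N -> p l < 1) \/
  [/\ 1 / 2 <= p j.+1 <= 1, forall l, (2 <= l <= j.+1)%N -> p l < 1,
      q <= z j, (0 < j)%N -> 3 / 2 * q <= z j &
      e j <= 1 - x ^+ 2 + q ^+ 2 - j.-1%:R * d * (9 / 4) * q ^+ 2].
  case: (claim J.+1 (leqnn _)) => // -[_ pl _ _ eJ1].
  exists J.+1; last by move=> l /andP[l2 lJ]; apply: pl; rewrite l2 ltnW.
  apply: le_lt_trans eJ1 _; rewrite -subr_gt0 /=.
  have -> : 1 - x ^+ 2 - (1 - x ^+ 2 + q ^+ 2 - J%:R * d * (9 / 4) * q ^+ 2) =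
    q ^+ 2 * (J%:R * d * (9 / 4) - 1) by ring.
  by apply: mulr_gt0; [apply: exprn_gt0|rewrite subr_gt0].
elim: j => [_|j IH jJ].
  right; split => //.
  - by rewrite p1; apply/andP; split; lra.
  - by move=> l /andP[l2 l1]; have := leq_trans l2 l1.
  - rewrite zE p0 p1 qE; lra.
  - by rewrite /= !mul0r subr0.
case: (IH (ltnW jJ)) => {IH}[|[/andP[pge ple] pl zq z3 ej]]; first by left.
have sx : 3 / 5 <= s j * x.
  by apply: (@le_trans _ _ (4 / 5 * (3 / 4))); [lra|apply: ler_pM => //; lra].
have pdec : p j.+2 < p j.+1.
  rewrite prec -zE; have := sge j => sj.
  have : 0 < s j * z j by apply: mulr_gt0; lra.
  have : 0 < (1 - x) * p j.+1 by apply: mulr_gt0; lra.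
  lra.
have pl' l : (2 <= l <= j.+2)%N -> p l < 1.
  move=> /andP[l2]; rewrite leq_eqVlt => /orP[/eqP->|lj]; first exact: lt_le_trans pdec ple.
  by apply: pl; rewrite l2.
have [small|large] := ltP (p j.+2) (1 / 2); last first.
  have ziter : 3 / 2 * q <= z j.+1.
    rewrite zrec; have [j0|/z3 z3'] := posnP j.
      by rewrite j0 zE p0 p1 qE; apply: velocity_start => //; rewrite -qE.
    by rewrite qE; apply: velocity_step => //; rewrite -qE.
  right; split => //.
  - by apply: le_trans ple; exact: ltW.
  - lra.
  - rewrite erec; case: (posnP j) => [j0|jgt].
      by rewrite j0 /= !mul0r subr0; apply: le_trans e0; rewrite lerBlDr lerDl mulr_ge0//
        sqr_ge0.
    have zz : (3 / 2 * q) ^+ 2 <= z j ^+ 2.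
      by rewrite ler_sqr ?nnegrE; [exact: z3|lra|lra].
    have : d * (3 / 2 * q) ^+ 2 <= (1 - s j ^+ 2) * z j ^+ 2.
      by apply: ler_pM => //; [exact: ltW|exact: sqr_ge0|apply: dle; exact: ltnW].
    have -> : j.+1.-1%:R = j.-1%:R + 1 :> R by rewrite natr1 prednK.
    have -> : d * (3 / 2 * q) ^+ 2 = d * (9 / 4) * q ^+ 2 by field.
    move: ej; set E1 := e j; set F := (1 - s j ^+ 2) * _.
    have -> : (j.-1%:R + 1) * d * (9 / 4) * q ^+ 2 =
      j.-1%:R * d * (9 / 4) * q ^+ 2 + d * (9 / 4) * q ^+ 2 by ring.
    lra.
left.
have [elt|ege] := ltP (e j.+1) (1 - x ^+ 2).
  by exists j.+1 => // l /andP[l2 lj]; apply: pl; rewrite l2.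
exists j.+2 => //; rewrite erec.
have zbig : 3 / 4 * (1 - x ^+ 2) <= z j.+1 ^+ 2.
  by rewrite zE; apply: velocity_crossing => //; rewrite -eE.
have : d * (3 / 4 * (1 - x ^+ 2)) <= (1 - s j.+1 ^+ 2) * z j.+1 ^+ 2.
  by apply: ler_pM => //; [exact: ltW|apply: mulr_ge0; [lra|exact: ltW]|exact: dle].
have : q * q < q * (d * (3 / 4) * (1 + x)) by rewrite ltr_pM2l.
have -> : d * (3 / 4 * (1 - x ^+ 2)) = q * (d * (3 / 4) * (1 + x)) by rewrite xxE; ring.
have := eJ j.+1; clear; move: (e j.+1) (_ * z j.+1 ^+ 2) => a1 a2; lra.
Qed.
End Slow.

Section SlowEnergy.
Variable (R : realFieldType) (b x : R).
Local Notation u n := (gegen b n).[x].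

Lemma damping_lower (k n : R) : 1 <= b -> 12 * b <= k -> k <= n -> n <= 2 * k + 1 ->
  7 / 8 * b / k <= 1 - (n / (n + b)) ^+ 2.
Proof.
move=> b1 kb kn nk.
have nb : 0 < n + b by lra.
have -> : 1 - (n / (n + b)) ^+ 2 = b * (2 * n + b) / (n + b) ^+ 2.
  by field; rewrite gt_eqF.
rewrite ler_pdivrMr; last lra.
rewrite [leRHS]mulrAC ler_pdivlMr; last by apply: exprn_gt0.
have h : 7 * (n + b) ^+ 2 <= 8 * k * (2 * n + b).
  rewrite -subr_ge0.
  have -> : 8 * k * (2 * n + b) - 7 * (n + b) ^+ 2 =
    n * (16 * k - 7 * n - 14 * b) + b * (8 * k - 7 * b) by ring.
  by apply: addr_ge0; apply: mulr_ge0; lra.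
have -> : 7 / 8 * b * (n + b) ^+ 2 = b / 8 * (7 * (n + b) ^+ 2) by field.
have -> : b * (2 * n + b) * k = b / 8 * (8 * k * (2 * n + b)) by field.
by apply: ler_wpM2l => //; lra.
Qed.

(** The Sturm bound gives (1 - x) k <= b and hence 1 - x <= 1 / 12, which makes
    [slow_dissipation] applicable with J = k - 1 and d = 7 b / (8 k). *)
Lemma energy_slow n (k := n.+1) : 1 <= b -> 12 * b <= k%:R -> x < 1 ->
  (1 - x) * ((k%:R + b) * (2 * k%:R + b + 1)) <= (b + 3) * (b + 5) ->
  u k < 0 -> u k < u n -> u k <= u k.+1 ->
  exists2 i, energy b x (k + i) < (1 - x ^+ 2) * u k ^+ 2 &
    forall l, (2 <= l <= i)%N -> u k < u (k + l)%N.
Proof.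
move=> b1 kb x1 hx un lt1 le1; have b0 : 0 < b by lra.
have [t et [t0 tlt]] := turn_drop b0 un le1 lt1.
rewrite -/k in et tlt.
set a := u k in un le1 lt1 et *.
have a0 : a != 0 by rewrite lt_eqF.
set kk : R := k%:R in kb hx tlt.
have kk0 : 0 < kk by rewrite ltr0n.
have qk : (1 - x) * kk <= b.
  have h1 : (1 - x) * (2 * kk ^+ 2) <= (1 - x) * ((kk + b) * (2 * kk + b + 1)).
    by apply: ler_wpM2l; [lra|nra].
  have h2 : (1 - x) * (2 * kk ^+ 2) <= 24 * b ^+ 2 by apply: le_trans h1 (le_trans hx _); nra.
  rewrite -(ler_pM2r kk0); apply: (@le_trans _ _ (12 * b ^+ 2)); nra.
have q12 : 1 - x <= 1 / 12 by nra.
pose s j : R := (k + j).+1%:R / ((k + j).+1%:R + b).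
pose p j := u (k + j)%N / a.
have sE j : ((k + j).+1%:R : R) = kk + j.+1%:R by rewrite -addnS natrD.
have h j : 0 < (k + j).+1%:R + b by rewrite addr_gt0.
have := @slow_dissipation R x (7 / 8 * b / kk) t s p k.-1.
case=> //.
- by lra.
- apply: le_trans (ltW tlt) _; apply: ler_wpM2r; first lra.
  have : kk / (kk + b) <= 1 by rewrite ler_pdivrMr; lra.
  lra.
- by rewrite /p addn0 divff.
- by rewrite /p addn1 et mulrC mulKf.
- move=> j; rewrite /p !addnS.
  apply: (mulfI a0); apply: (mulfI (lt0r_neq0 (h j))).
  have -> : ((k + j).+1%:R + b) * (a * (u (k + j).+2 / a)) = ((k + j).+1%:R + b) * u (k + j).+2.
    by rewrite [a * _]mulrC divfK.
  rewrite gegen_rec// /s; move: (h j); move: ((k + j).+1%:R : R) => m hm.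
  by field; rewrite a0 gt_eqF.
- move=> j; rewrite /s ler_pdivlMr//; have : (0:R) < j.+1%:R by []. 
  by rewrite sE; move: (j.+1%:R : R) => m; lra.
- by move=> j; rewrite /s ltr_pdivrMr// mul1r ltrDl.
- move=> j jk; rewrite /s; apply: damping_lower => //; rewrite -/kk sE.
  + by rewrite lerDl.
  + rewrite prednK// in jk. have : (j.+1%:R : R) <= kk + 1 by rewrite natr1 ler_nat.
    move: (j.+1%:R : R) => m; lra.
- by rewrite divr_gt0//; lra.
- have -> : k.-1%:R = kk - 1 by rewrite /kk /k -natr1 addrK.
  have -> : (kk - 1) * (7 / 8 * b / kk) * (9 / 4) = (63 / 32 * b * (kk - 1)) / kk.
    by field; rewrite gt_eqF.
  rewrite ltr_pdivlMr//; nra.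
- have -> : 7 / 8 * b / kk * (3 / 4) * (1 + x) = (21 / 32 * b * (1 + x)) / kk.
    by field; rewrite gt_eqF.
  rewrite ltr_pdivlMr//; apply: le_lt_trans qk _; nra.
move=> i ei pl; exists i.
  have -> : energy b x (k + i) =
    a ^+ 2 * ((1 - x ^+ 2) * p i.+1 ^+ 2 + (p i - x * p i.+1) ^+ 2).
    by rewrite /energy /p addnS; field.
  by rewrite [X in _ < X]mulrC ltr_pM2l// exprn_even_gt0.
by move=> l li; have := pl l li; rewrite /p ltr_ndivrMr// mul1r.
Qed.
End SlowEnergy.

(** * The first two turns *)

(** With h = (b + 4) x^2 the right-hand side is at least h^2 - 6 h + 3 >= -2, while the
    left-hand side is at most -8/3. *)
Lemma poly_fourth (R : realFieldType) (b x v : R) :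
  1 <= b -> (b + 4) * x ^+ 2 <= 1 -> (b + 2) * v <= -1 ->
  v * ((b + 1) * (b + 3)) <
  (b + 4) * (b + 6) * x ^+ 4 - 6 * (b + 4) * x ^+ 2 + 3.
Proof.
move=> b1 h1 hv; have Y0 := sqr_ge0 x.
have vle : v * ((b + 1) * (b + 3)) <= - (8 / 3).
  rewrite -(ler_pM2l (_ : 0 < b + 2)); last lra.
  have b13 : 0 <= (b + 1) * (b + 3) by apply: mulr_ge0; lra.
  have := ler_wpM2l b13 hv.
  have : 0 <= (b - 1) * (b + 7 / 3) by apply: mulr_ge0; lra.
  lra.
have x4 : (b + 4) * (b + 6) * x ^+ 4 =
  ((b + 4) * x ^+ 2) ^+ 2 + 2 * (x ^+ 2 * ((b + 4) * x ^+ 2)) by ring.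
have h0 : 0 <= (b + 4) * x ^+ 2 by apply: mulr_ge0 => //; lra.
have Yh : 0 <= x ^+ 2 * ((b + 4) * x ^+ 2) by apply: mulr_ge0.
rewrite x4 -mulrA; move: h0 h1 Yh; move: (_ * x ^+ 2) => h h0 h1 Yh.
have h5 : 0 <= (1 - h) * (5 - h) by apply: mulr_ge0; lra.
lra.
Qed.

Section FirstTurns.
Variable (R : realFieldType) (b x : R).
Local Notation u n := (gegen b n).[x].
Local Notation K n := (kern b n).[x].

Lemma gegen_low : 0 < b ->
  [/\ u 2 = ((b + 2) * x ^+ 2 - 1) / (b + 1),
      u 3 = x * ((b + 4) * x ^+ 2 - 3) / (b + 1),
      u 4 = ((b + 4) * (b + 6) * x ^+ 4 - 6 * (b + 4) * x ^+ 2 + 3) / ((b + 1) * (b + 3)),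
      u 5 = x * ((b + 6) * (b + 8) * x ^+ 4 - 10 * (b + 6) * x ^+ 2 + 15) / ((b + 1) * (b +
        3)) &
      u 6 = ((b + 6) * (b + 8) * (b + 10) * x ^+ 6 - 15 * (b + 6) * (b + 8) * x ^+ 4
              + 45 * (b + 6) * x ^+ 2 - 15) / ((b + 1) * (b + 3) * (b + 5))].
Proof.
move=> b0; have nz i : i.+1%:R + b != 0 by rewrite gt_eqF// addr_gt0.
have step n v : (n.+1%:R + b) * v =
  (2 * n.+1%:R + b) * x * u n.+1 - n.+1%:R * u n -> u n.+2 = v.
  by rewrite -gegen_rec// => /(mulfI (nz n)).
have [n1 n3 n5] : [/\ b + 1 != 0, b + 3 != 0 & b + 5 != 0].
  by split; rewrite gt_eqF// addr_gt0.
have u0 : u 0 = 1 by rewrite /= hornerC.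
have u1 : u 1 = x by rewrite /= hornerX.
have u2 : u 2 = ((b + 2) * x ^+ 2 - 1) / (b + 1).
  by apply: step; rewrite u0 u1; field.
have u3 : u 3 = x * ((b + 4) * x ^+ 2 - 3) / (b + 1).
  by apply: step; rewrite u1 u2; field.
have u4 : u 4 = ((b + 4) * (b + 6) * x ^+ 4 - 6 * (b + 4) * x ^+ 2 + 3) / ((b + 1) * (b + 3)).
  by apply: step; rewrite u2 u3; field; rewrite n3 n1.
have u5 : u 5 = x * ((b + 6) * (b + 8) * x ^+ 4 - 10 * (b + 6) * x ^+ 2 + 15) / ((b +
  1) * (b + 3)).
  by apply: step; rewrite u3 u4; field; rewrite n3 n1.
split => //.
by apply: step; rewrite u4 u5; field; rewrite n5 n3 n1.
Qed.

Lemma kern1 : 0 < b -> K 1 = (1 + (b + 2) * x) / (b + 1).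
Proof.
move=> b0; have n1 : 1 + b != 0 by rewrite gt_eqF// addr_gt0.
by rewrite /= !(hornerZ, hornerD, hornerX, hornerC); field; rewrite addrC.
Qed.

Lemma kern2 : 0 < b -> x < 1 -> K 2 = ((b + 4) * x ^+ 2 + 2 * x - 1) / (b + 1).
Proof.
move=> b0 x1; have n1 : b + 1 != 0 by rewrite gt_eqF// addr_gt0.
have q : 1 - x != 0 by rewrite gt_eqF// subr_gt0.
apply: (mulfI q); rewrite -gegen_diff//.
by have [-> -> _ _ _] := gegen_low b0; field.
Qed.

(** The energy per unit of 1 - x^2 is less than (b + 2)^-2, which is at most the square
    of the value at the turn both for k = 1 and for k = 2, x < 0. *)
Lemma energy_six_small : 1 <= b -> -1 < x -> x < 1 -> b * (b + 4) * x ^+ 2 <= 1 ->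
  (b + 2) ^+ 2 * energy b x 6 < 1 - x ^+ 2.
Proof.
move=> b1 xN1 x1 hx; have b0 : 0 < b by lra.
have [_ _ _ e5 e6] := gegen_low b0.
have -> : energy b x 6 = (1 - x ^+ 2) * u 6 ^+ 2 + (6 / (6 + b)) ^+ 2 * (u 5 - x * u 6) ^+ 2.
  by rewrite energyS// /energy; ring.
have P := one_sub_sqr_gt0 xN1 x1.
have := @poly_sixth R (b - 1) (x ^+ 2).
have -> : 1 + (b - 1) = b by ring.
have -> : (b - 1 + 1) * (b - 1 + 5) = b * (b + 4) by ring.
have bb : 0 <= b - 1 by lra.
move=> /(_ bb (sqr_ge0 _) hx); cbv zeta.
set D := (b + 1) * (b + 3) * (b + 5) => H.
set N := (X in _ * X < _) in H.
have D0 : 0 < D by rewrite /D; do 2?[apply: mulr_gt0]; lra.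
have -> : (b + 2) ^+ 2 * ((1 - x ^+ 2) * u 6 ^+ 2 + (6 / (6 + b)) ^+ 2 * (u 5 - x * u 6) ^+ 2)
  = (1 - x ^+ 2) * (((b + 2) ^+ 2 * N) / D ^+ 2).
  rewrite e5 e6 /N /D; field; do ?[apply/andP; split]; rewrite gt_eqF//; lra.
by rewrite -[ltRHS]mulr1 ltr_pM2l// ltr_pdivrMr ?exprn_gt0// mul1r.
Qed.

(** For b = 1 and x = -1/3 the values at the degrees 1, 2 and 5 coincide, so no
    crude estimate can work here. Far from x = -1/(b + 2) the energy is small enough
    after one step; close to it the degrees 3, 4, 5 are compared explicitly, and
    [energy_six_small] takes care of the rest. *)
Lemma first_turn m : 1 < b -> -1 < x -> x < 1 -> K 1 <= 0 -> (3 <= m)%N -> u 1 < u m.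
Proof.
move=> b1 xN1 x1 + m3; have b0 : 0 < b by lra.
have b10 : 0 < b + 1 by lra.
rewrite kern1// pmulr_lle0 ?invr_gt0// => hx.
have xneg : x < 0 by nra.
have u1 : u 1 = x by rewrite /= hornerX.
have u1n : u 1 < 0 by rewrite u1.
have [e2 e3 e4 e5 _] := gegen_low b0.
have P := one_sub_sqr_gt0 xN1 x1.
have [big|small] := ltP 1 (b * (b + 4) * x ^+ 2).
  apply: (gegen_gt_of_energy b0 xN1 x1 u1n (n := 2%N)) (ltnW m3).
  have -> : energy b x 2 = (1 - x ^+ 2) * u 2 ^+ 2 + (2 / (2 + b)) ^+ 2 * (u 1 - x * u 2) ^+ 2.
    by rewrite energyS// /energy; ring.
  rewrite u1 e2 -subr_gt0.
  have -> : (1 - x ^+ 2) * x ^+ 2 - ((1 - x ^+ 2) * (((b + 2) * x ^+ 2 - 1) / (b + 1)) ^+ 2 +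
      (2 / (2 + b)) ^+ 2 * (x - x * (((b + 2) * x ^+ 2 - 1) / (b + 1))) ^+ 2)
    = (1 - x ^+ 2) ^+ 2 * (b * (b + 4) * x ^+ 2 - 1) / (b + 1) ^+ 2.
    by field; do ?[apply/andP; split]; rewrite gt_eqF//; lra.
  by apply: divr_gt0; [apply: mulr_gt0; [exact: exprn_gt0|lra]|exact: exprn_gt0].
have Y1 : 1 <= (b + 2) ^+ 2 * x ^+ 2.
  rewrite -exprMn; have : 1 <= - ((b + 2) * x) by lra.
  by move: ((b + 2) * x) => z; nra.
have late := energy_six_small (ltW b1) xN1 x1 small.
have [m6|] := leqP 6 m.
  apply: (gegen_gt_of_energy b0 xN1 x1 u1n (n := 6%N)) m6.
  rewrite u1 -(ltr_pM2l (_ : 0 < (b + 2) ^+ 2)); last by apply: exprn_gt0; lra.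
  apply: lt_le_trans late _.
  by rewrite mulrCA -[leLHS]mulr1 ler_pM2l.
have b4 : (b + 4) * x ^+ 2 <= 1.
  by have := sqr_ge0 x; move: small; move: (x ^+ 2) => Y; nra.
case: m m3 => [|[|[|[|[|[|m]]]]]]// _ _.
- rewrite u1 e3; apply: (lt_le_trans xneg).
  rewrite pmulr_lge0 ?invr_gt0//; apply: mulr_le0; [exact: ltW|lra].
- rewrite u1 e4 ltr_pdivlMr; first by apply: poly_fourth => //; lra.
  by apply: mulr_gt0; lra.
- rewrite u1 e5 ltr_pdivlMr; last by apply: mulr_gt0; lra.
  (* This factorisation vanishes at b = 1, x = -1/3. *)
  rewrite ltr_nM2l// -subr_gt0.
  have -> : (b + 1) * (b + 3) - ((b + 6) * (b + 8) * x ^+ 4 - 10 * (b + 6) * x ^+ 2 + 15) =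
     (b + 6) * ((1 - x ^+ 2) * ((b + 8) * x ^+ 2 - (2 - b))) by ring.
  apply: mulr_gt0; first lra.
  apply: mulr_gt0 => //.
  rewrite -(pmulr_rgt0 _ (_ : 0 < (b + 2) ^+ 2)); last by apply: exprn_gt0; lra.
  by nra.
Qed.

(** For x >= 0 the energy is small enough after two steps. For x < 0 the turn is close
    to the tie at x = -1/(b + 2) and is treated as in [first_turn]. *)
Lemma second_turn m : 1 < b -> -1 < x -> x < 1 -> 0 < K 1 -> K 2 <= 0 -> (4 <= m)%N ->
  u 2 < u m.
Proof.
move=> b1 xN1 x1 + + m4; have b0 : 0 < b by lra.
have b10 : 0 < b + 1 by lra.
rewrite kern1// kern2// pmulr_lgt0 ?invr_gt0// pmulr_lle0 ?invr_gt0// => hx hx2.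
have [e2 e3 e4 e5 _] := gegen_low b0.
have P := one_sub_sqr_gt0 xN1 x1.
have u2n : u 2 < 0.
  rewrite e2 pmulr_llt0 ?invr_gt0//; nra.
have [x0|xneg] := leP 0 x.
  apply: (gegen_gt_of_energy b0 xN1 x1 u2n (n := 4%N)) m4.
  have -> : energy b x 4 = (1 - x ^+ 2) * u 4 ^+ 2 + (4 / (4 + b)) ^+ 2 * (u 3 - x * u 4) ^+ 2.
    by rewrite energyS// /energy; ring.
  have := @poly_second_turn R (b - 1) x.
  have -> : 1 + (b - 1) = b by ring.
  have -> : b - 1 + 5 = b + 4 by ring.
  have bb : 0 <= b - 1 by lra.
  move=> /(_ bb x0 hx2); cbv zeta => H.
  rewrite e2 e3 e4.
  set D := (b + 1) * (b + 3).
  have D0 : 0 < D by apply: mulr_gt0; lra.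
  rewrite -subr_gt0 in H; rewrite -subr_gt0.
  have E : (1 - x ^+ 2) * (((b + 2) * x ^+ 2 - 1) / (b + 1)) ^+ 2 -
     ((1 - x ^+ 2) * (((b + 4) * (b + 6) * x ^+ 4 - 6 * (b + 4) * x ^+ 2 + 3) / D) ^+ 2
       + (4 / (4 + b)) ^+ 2 * (x * ((b + 4) * x ^+ 2 - 3) / (b + 1) -
         x * (((b + 4) * (b + 6) * x ^+ 4 - 6 * (b + 4) * x ^+ 2 + 3) / D)) ^+ 2)
    = (1 - x ^+ 2) * ((b + 3) ^+ 2 * (1 - (b + 2) * x ^+ 2) ^+ 2 -
        (((b + 4) * (b + 6) * (x ^+ 2) ^+ 2 - 6 * (b + 4) * x ^+ 2 + 3) ^+ 2 +
      16 * x ^+ 2 * (1 - x ^+ 2) * ((b + 6) * x ^+ 2 - 3) ^+ 2)) / D ^+ 2.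
    by rewrite /D; field; do ?[apply/andP; split]; rewrite gt_eqF//; lra.
  by rewrite E; apply: divr_gt0; [exact: mulr_gt0|exact: exprn_gt0].
have small : (b + 2) ^+ 2 * x ^+ 2 <= 1.
  rewrite -exprMn; have : - ((b + 2) * x) <= 1 by lra.
  have : 0 <= - ((b + 2) * x) by nra.
  by move: ((b + 2) * x) => z; nra.
have Y0 := sqr_ge0 x.
have small' : b * (b + 4) * x ^+ 2 <= 1 by move: small Y0; move: (x ^+ 2) => Y; nra.
have late := energy_six_small (ltW b1) xN1 x1 small'.
have c1 : 1 <= (b + 2) ^+ 2 * u 2 ^+ 2.
  rewrite -exprMn e2.
  have -> : (b + 2) * (((b + 2) * x ^+ 2 - 1) / (b + 1)) =
    - ((b + 2) * (1 - (b + 2) * x ^+ 2) / (b + 1)).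
    by field; rewrite gt_eqF.
  rewrite sqrrN; have : 1 <= (b + 2) * (1 - (b + 2) * x ^+ 2) / (b + 1).
    by rewrite ler_pdivlMr// mul1r; lra.
  by move: (_ / _) => z; nra.
have [m6|] := leqP 6 m.
  apply: (gegen_gt_of_energy b0 xN1 x1 u2n (n := 6%N)) m6.
  rewrite -(ltr_pM2l (_ : 0 < (b + 2) ^+ 2)); last by apply: exprn_gt0; lra.
  apply: lt_le_trans late _.
  by rewrite mulrCA -[leLHS]mulr1 ler_pM2l.
case: m m4 => [|[|[|[|[|[|m]]]]]]// _ _.
- have u2b : (b + 2) * u 2 <= -1.
    move: c1; rewrite -exprMn; have : (b + 2) * u 2 < 0 by nra.
    by move: ((b + 2) * u 2) => z; nra.
  have b4 : (b + 4) * x ^+ 2 <= 1.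
    by move: small' Y0; move: (x ^+ 2) => Y; nra.
  rewrite e4 ltr_pdivlMr; first by apply: poly_fourth => //; exact: ltW.
  by apply: mulr_gt0; lra.
- have := @poly_fifth R (b - 1) (- x).
  have -> : 1 + (b - 1) = b by ring.
  have -> : b - 1 + 3 = b + 2 by ring.
  have [bb xx] : 0 <= b - 1 /\ 0 <= - x by split; lra.
  have zz : 0 < 1 - (b + 2) * - x by lra.
  move=> /(_ bb xx zz); cbv zeta; rewrite sqrrN => H.
  rewrite -subr_gt0 in H; rewrite e2 e5 -subr_gt0.
  have pos : forall l, l = ((b + 3) * (1 - (b + 2) * x ^+ 2) -
       - x * ((b + 6) * (b + 8) * (x ^+ 2) ^+ 2 - 10 * (b + 6) * x ^+ 2 + 15)) / ((b +
         1) * (b + 3)) -> 0 < l.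
    by move=> l ->; rewrite divr_gt0// mulr_gt0//; lra.
  by apply: pos; field; do ?[apply/andP; split]; rewrite gt_eqF//; lra.
Qed.
End FirstTurns.

(** * Turning points *)

Section Turning.
Variable (R : realFieldType) (b x : R).
Local Notation u n := (gegen b n).[x].
Local Notation K n := (kern b n).[x].

Lemma gegen_turn_lt0 n : 0 < b -> 0 < K n -> K n.+1 <= 0 -> u n.+1 < 0.
Proof.
move=> b0 Kn Kn1; have := kern_gegen b0 n x.
have h1 : (n.+1%:R + b) * K n.+1 <= 0 by rewrite pmulr_rle0// addr_gt0.
have h2 : 0 < n.+1%:R * K n by rewrite mulr_gt0.
move=> e; rewrite -(pmulr_rlt0 _ (_ : 0 <
  2 * n.+1%:R + b)); last by rewrite addr_gt0// mulr_gt0.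
lra.
Qed.

(** The core of the argument: once the sequence has turned, it stays strictly
    above the value at the turn from the second next term on. *)
Lemma gegen_after_turn k : 1 < b -> -1 < x -> x < 1 ->
  (forall j, (j <= k)%N -> 0 < K j) -> K k.+1 <= 0 ->
  forall m, (k.+3 <= m)%N -> u k.+1 < u m.
Proof.
move=> b1 xN1 x1 Kpos Kneg m km; have b0 : 0 < b by lra.
have q0 : 0 < 1 - x by lra.
have un := gegen_turn_lt0 b0 (Kpos k (leqnn k)) Kneg.
have lt1 : u k.+1 < u k.
  by rewrite -subr_gt0 gegen_diff// mulr_gt0// Kpos.
have le1 : u k.+1 <= u k.+2.
  by rewrite -subr_le0 gegen_diff// pmulr_rle0.
case: k Kpos Kneg un lt1 le1 km => [|[|k]] Kpos Kneg un lt1 le1 km.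
- exact: first_turn.
- by apply: second_turn => //; exact: Kpos.
have hq' : (1 - x) * ((k.+3%:R + b) * (2 * k.+3%:R + b + 1)) <= (b + 3) * (b + 5).
  by apply: ltW; apply: kern_pos_bound => // j jk; exact: Kpos.
have [fast|slow] := lerP (k.+3%:R) (12 * b).
  apply: (gegen_gt_of_energy b0 xN1 x1 un (n := k.+3.+2)) km.
  by apply: energy_moderate => //; lra.
have [i ei pl] := energy_slow (ltW b1) (ltW slow) x1 hq' un lt1 le1.
have [im|mi] := leqP (k.+3 + i) m.
  exact: (gegen_gt_of_energy b0 xN1 x1 un ei) im.
have -> : m = (k.+3 + (m - k.+3))%N by rewrite subnKC// (leq_trans _ km)// leqW.
apply: pl; rewrite ltn_subRL addn1 km /=.
by rewrite leq_subLR ltnW.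
Qed.

End Turning.

Section Roots.
Variable (R : realType) (b : R).
Hypothesis b_gt0 : 0 < b.
Local Notation K n x := (kern b n).[x].

(** The position of the n-th turning point, characterised by the sign of [kern];
    for n > 0 this makes r the largest root. *)
Definition is_xi n (r : R) : Prop :=
  if n is 0 then r = -1 else K n r = 0 /\ forall y, r < y -> 0 < K n y.

Lemma is_xi_pos n r y : is_xi n r -> r < y -> 0 < K n y.
Proof. by case: n => [_ _|n [_]]; [rewrite /= hornerC|exact]. Qed.

Lemma is_xi_inj n r r' : is_xi n r -> is_xi n r' -> r = r'.
Proof.
case: n => [-> ->//|n [e p] [e' p']].
apply/eqP; rewrite eq_le !leNgt; apply/andP; split; apply/negP.
- by move/p'; rewrite e ltxx.
- by move/p; rewrite e' ltxx.
Qed.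

(** The ratio of [kern n.+1] to [kern n] increases to the right of r, written
    without denominators. *)
Definition ratio_incr n (r : R) := forall x y, r < x -> x < y -> 
  K n.+1 x * K n y < K n.+1 y * K n x.

Lemma ratio_incr0 : ratio_incr 0 (-1).
Proof.
move=> x y _ xy; rewrite [kern b 0]/= !hornerC !mulr1 !kern1//.
have h : 0 < b + 1 by rewrite addr_gt0.
rewrite ltr_pM2r ?invr_gt0// ltrD2l ltr_pM2l// addr_gt0//.
Qed.

(** Dividing the three-term relation by the middle term, the next ratio equals an
    increasing affine function of x minus a positive constant over the
    present ratio. *)
Lemma ratio_incrS n r : (forall y, r < y -> 0 < K n.+1 y) -> (forall y, r < y -> 0 < K n y) ->
  ratio_incr n r -> ratio_incr n.+1 r.
Proof.
move=> K1 K0 inc x y rx xy; have ry := lt_trans rx xy.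
set m : R := n.+1%:R.
have m0 : 0 < m by rewrite ltr0n.
have b0 := b_gt0.
have A0 : 0 < (m + b + 1) * (2 * m + b) by apply: mulr_gt0; lra.
rewrite -(ltr_pM2l A0) !mulrA !kern_rec// -/m -subr_gt0.
have := inc _ _ rx xy; rewrite -subr_gt0.
have := K1 _ rx; have := K1 _ ry.
move: (K n.+1 x) (K n.+1 y) (K n x) (K n y) => kx ky lx ly ky0 kx0 H.
rewrite (_ : _ - _ = (y - x) * ((2 * m + b) * (2 * m + b + 2)) * (kx * ky) + m * (2 * m + b +
  2) * (ky * lx - kx * ly)); last ring.
apply: addr_gt0; apply: mulr_gt0 => //.
- by apply: mulr_gt0; [rewrite subr_gt0|apply: mulr_gt0; lra].
- exact: mulr_gt0.
- by apply: mulr_gt0; lra.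
Qed.

Lemma kern_at1_gt0 n : 0 < K n 1.
Proof.
have b0 := b_gt0; rewrite kern_at1//; apply: divr_gt0; last by rewrite addr_gt0.
have : (0 : R) <= n%:R by rewrite ler0n.
by move: (n%:R : R) => k; lra.
Qed.

(** [kern n.+1] is negative at r and positive at 1, so it vanishes at some r' in
    between; monotonicity of the ratio makes r' its only zero to the right of r,
    and the three-term relation makes [kern n.+2] negative at r'. *)
Lemma is_xi_step n r : is_xi n r -> r < 1 -> ratio_incr n r -> K n.+1 r < 0 ->
  exists r', [/\ is_xi n.+1 r', r < r', r' < 1, ratio_incr n.+1 r' & K n.+2 r' < 0]
    /\ (forall y, r < y -> y < r' -> K n.+1 y < 0).
Proof.
move=> xin r1 inc Kr.
have K1 := kern_at1_gt0 n.+1.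
have [|r' /andP[rr' r'1] /rootP Kr'] := @poly_ivt R (kern b n.+1) _ _ (ltW r1).
  by rewrite !ltW.
have {}rr' : r < r'.
  by rewrite lt_neqAle rr' andbT; apply: contraTneq Kr => ->; rewrite Kr' ltxx.
have {}r'1 : r' < 1.
  by rewrite lt_neqAle r'1 andbT; apply: contraTneq K1 => <-; rewrite Kr' ltxx.
have pos := is_xi_pos xin.
have xi' : is_xi n.+1 r'.
  split=> // y r'y; have := inc _ _ rr' r'y.
  by rewrite Kr' mul0r pmulr_lgt0// pos.
have pos' := is_xi_pos xi'.
exists r'; split; last first.
  move=> y ry yr'; have := inc _ _ ry yr'.
  by rewrite Kr' mul0r pmulr_llt0// pos.
split=> //.
  apply: ratio_incrS => //; first by move=> y r'y; apply: pos; exact: lt_trans r'y.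
  by move=> x y r'x; apply: inc; exact: lt_trans r'x.
have := kern_rec b_gt0 n r'; rewrite Kr' mulr0 sub0r => e.
have b0 := b_gt0.
set m : R := n.+1%:R in e.
have m0 : 0 < m by rewrite ltr0n.
have A0 : 0 < (m + b + 1) * (2 * m + b) by apply: mulr_gt0; lra.
rewrite -(pmulr_rlt0 _ A0) e oppr_lt0; apply: mulr_gt0; last exact: pos.
by apply: mulr_gt0; lra.
Qed.

Lemma is_xi_chain n : exists r r', [/\ is_xi n r, is_xi n.+1 r', r < r', r' < 1 &
    forall y, r < y -> y < r' -> K n.+1 y < 0].
Proof.
suff [r [xin r1 inc Kr]] : exists r, [/\ is_xi n r, r < 1, ratio_incr n r & K n.+1 r < 0].
  have [r' [[? ? ? ? ?] neg]] := is_xi_step xin r1 inc Kr.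
  by exists r, r'; split.
elim: n => [|n [r [xin r1 inc Kr]]].
  exists (-1); split; [by []|by rewrite gtrN|exact: ratio_incr0|].
  rewrite kern1//; have b0 := b_gt0.
  by rewrite pmulr_llt0 ?invr_gt0; [lra|lra].
by have [r' [[? ? ? ? ?] _]] := is_xi_step xin r1 inc Kr; exists r'.
Qed.

End Roots.

(** * Location of the minima *)

Section Minima.
Variable (R : realType) (b x : R) (X : nat -> R).
Hypothesis b_gt1 : 1 < b.
Hypothesis x_gtN1 : -1 < x.
Hypothesis x_lt1 : x < 1.
Hypothesis X_xi : forall n, is_xi b n (X n).
Local Notation u n := (gegen b n).[x].
Local Notation K n := (kern b n).[x].

Let b0 : 0 < b. Proof. by have := b_gt1; lra. Qed.

Lemma xi_step n : X n < X n.+1 /\ forall y, X n < y -> y < X n.+1 -> (kern b n.+1).[y] < 0.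
Proof.
have [r [r' [xr xr' rr' _ neg]]] := is_xi_chain b0 n.
by rewrite (is_xi_inj (X_xi n) xr) (is_xi_inj (X_xi n.+1) xr').
Qed.

Lemma xi_lt m n : (X m < X n) = (m < n)%N.
Proof.
have lt p q : (p < q)%N -> X p < X q.
  elim: q => // q IH; rewrite ltnS leq_eqVlt => /orP[/eqP->|/IH h].
    by have [] := xi_step q.
  by apply: lt_trans h _; have [] := xi_step q.
apply/idP/idP; last exact: lt.
by apply: contraTT; rewrite -leqNgt -leNgt leq_eqVlt => /orP[/eqP->//|/lt/ltW].
Qed.

Lemma kern_turns : exists n, K n <= 0.
Proof.
apply: contrapT => noK.
have Kpos n : 0 < K n by rewrite ltNge; apply/negP => Kn; apply: noK; exists n.
have h k : (1 - x) * k%:R <= (b + 3) * (b + 5).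
  apply: le_trans (ltW (kern_pos_bound b0 (k := k) (fun j _ => Kpos j))).
  apply: ler_wpM2l; first by rewrite subr_ge0 ltW.
  have : (0 : R) <= k%:R by [].
  rewrite -[k.+2]addn2 natrD; move: (k%:R : R) => t; have := b0; nra.
have q0 : 0 < 1 - x by rewrite subr_gt0.
have := h (Num.truncn ((b + 3) * (b + 5) / (1 - x))).+1.
apply/negP; rewrite -ltNge -ltr_pdivrMl// mulrC.
exact: truncnS_gt.
Qed.

Lemma xi_kern n : (0 < n)%N -> x <= X n -> exists2 j, (j <= n)%N & K j <= 0.
Proof.
elim: n => // n IH _ xn.
have [xle|xgt] := leP x (X n).
  case: n IH xn xle => [|n] IH xn xle.
    by move: (X_xi 0) xle => /= ->; rewrite leNgt x_gtN1.
  by have [j jn Kj] := IH isT xle; exists j => //; exact: leqW.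
exists n.+1 => //; move: xn; rewrite le_eqVlt => /orP[/eqP->|xlt].
  by have [-> _] := X_xi n.+1.
by apply: ltW; have [_] := xi_step n; apply.
Qed.

(** The turn occurs at the least degree k.+1 where [kern] is nonpositive at x. It
    exists because the Sturm bound fails for large degrees. *)
Lemma turning_index : exists k,
  [/\ X k < x <= X k.+1, forall j, (j <= k)%N -> u j.+1 < u j,
      forall m, (k.+3 <= m)%N -> u k.+1 < u m,
      x = X k.+1 -> u k.+2 = u k.+1 &
      x <> X k.+1 -> u k.+1 < u k.+2].
Proof.
have [k0 Kk0 min] := ex_minnP kern_turns.
case: k0 Kk0 min => [|k] Kk min; first by move: Kk; rewrite /= hornerC ler10.
have Kpos j : (j <= k)%N -> 0 < K j.
  by move=> jk; rewrite ltNge; apply/negP => /min; rewrite ltnNge jk.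
have q0 : 0 < 1 - x by rewrite subr_gt0.
have xk : X k < x.
  case: k Kk min Kpos => [|k] Kk min Kpos; first by have /= -> := X_xi 0.
  rewrite ltNge; apply/negP => h; have [j jk] := @xi_kern k.+1 isT h; apply/negP.
  by rewrite -ltNge Kpos.
exists k; split.
- rewrite xk leNgt; apply/negP => h; move: Kk; apply/negP; rewrite -ltNge.
  by have [_] := X_xi k.+1; apply.
- by move=> j jk; rewrite -subr_gt0 gegen_diff// mulr_gt0// Kpos.
- by move=> m; apply: gegen_after_turn.
- move=> e; apply/eqP; rewrite eq_sym -subr_eq0 gegen_diff// mulf_eq0.
  by have [h _] := X_xi k.+1; rewrite {2}e h eqxx orbT.
move=> ne; rewrite -subr_lt0 gegen_diff// pmulr_rlt0//.
have [_ neg] := xi_step k; apply: neg => //.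
rewrite lt_neqAle; apply/andP; split; first exact/eqP.
rewrite leNgt; apply/negP => h; move: Kk; apply/negP; rewrite -ltNge.
by have [_] := X_xi k.+1; apply.
Qed.

Lemma gegen_minima :
  let min_at k := forall n, u k <= u n in
  (forall k, (1 <= k)%N -> (min_at k <-> X k.-1 <= x <= X k)) /\
  (forall k, (1 <= k)%N ->
     (X k.-1 < x < X k -> forall m, min_at m <-> m = k) /\
     (x = X k -> forall m, min_at m <-> m = k \/ m = k.+1)) /\
  (forall k, min_at k -> forall j, (j < k)%N -> u j.+1 <= u j).
Proof.
have [k0 [/andP[xl xr] dec late tie notie]] := turning_index.
move=> min_at.
have dec' j : (j <= k0)%N -> u k0.+1 < u j.
  have down d i : (i + d = k0)%N -> u k0.+1 < u i.
    elim: d i => [|d IH] i e; first by move: e; rewrite addn0 => ->; exact: dec.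
    by apply: lt_trans (dec _ _); [apply: IH; rewrite -e addSnnS|rewrite -e leq_addr].
  by move/subnKC/down.
have next : u k0.+1 <= u k0.+2.
  by have [/tie->//|/eqP/notie/ltW] := eqVneq x (X k0.+1).
have min0 : min_at k0.+1.
  move=> n; have [nk|nk] := leqP n k0; first by apply: ltW; apply: dec'.
  move: nk; rewrite leq_eqVlt => /orP[/eqP<-//|].
  by rewrite leq_eqVlt => /orP[/eqP<-//|nk]; apply: ltW; apply: late.
have minP m : min_at m <-> m = k0.+1 \/ (m = k0.+2 /\ x = X k0.+1).
  split=> [mm|[->//|[-> e]]]; last by move=> n; rewrite (tie e).
  have [mk|mk] := leqP m k0.
    by have := dec' m mk; rewrite ltNge mm.
  move: mk; rewrite leq_eqVlt => /orP[/eqP<-|mk]; first by left.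
  right; move: mk; rewrite leq_eqVlt => /orP[/eqP em|mk].
    rewrite -em in mm *; split=> //; apply/eqP/negPn/negP => /eqP/notie.
    by rewrite ltNge mm.
  by have := late _ mk; rewrite ltNge mm.
have dle j : (j < k0.+1)%N -> u j.+1 <= u j by move=> jk; apply/ltW/dec.
have idx_lt i : X k0 < X i -> (k0 < i)%N by rewrite xi_lt.
split; [|split].
- move=> k k1; rewrite minP; split=> [[->|[-> e]]|/andP[h1 h2]].
  + by rewrite ltW.
  + by rewrite /= -e lexx /= e ltW// xi_lt.
  have ki := idx_lt _ (lt_le_trans xl h2).
  have : X k.-1 <= X k0.+1 by apply: le_trans xr.
  rewrite leNgt xi_lt -leqNgt => ki2.
  have : (k <= k0.+2)%N by rewrite -(prednK k1).
  rewrite leq_eqVlt => /orP[/eqP e|ki3]; last first.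
    by left; apply/eqP; rewrite eqn_leq ki andbT.
  right; split=> //; apply/eqP; rewrite eq_le xr /=.
  by move: h1; rewrite e.
- move=> k k1; split=> [/andP[h1 h2] m|e m]; rewrite minP.
    have ki := idx_lt _ (lt_trans xl h2).
    have : X k.-1 < X k0.+1 by apply: lt_le_trans xr.
    rewrite xi_lt ltnS => ki2.
    have ek : k = k0.+1 by apply/eqP; rewrite eqn_leq ki andbT -(prednK k1).
    rewrite ek; split=> [[//|[_ e]]|]; last by left.
    by move: h2; rewrite ek -e ltxx.
  have ki : (k0 < k)%N by apply: idx_lt; rewrite -e.
  have : X k <= X k0.+1 by rewrite -e.
  rewrite leNgt xi_lt -leqNgt => ki2.
  have ek : k = k0.+1 by apply/eqP; rewrite eqn_leq ki andbT.
  rewrite ek in e *; split=> [[->|[-> _]]|[->|->]]; [by left|by right|by left|by right].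
move=> k /minP[->|[-> e]] j; first exact: dle.
rewrite ltnS leq_eqVlt => /orP[/eqP->|]; last exact: dle.
by rewrite (tie e).
Qed.
End Minima.

(** * Integrals against the weight *)

Section Weight.
Local Open Scope classical_set_scope.
Local Open Scope ring_scope.
Variable R : realType.
Implicit Types (a : R) (p : {poly R}).

Lemma one_sub_at_left : (fun x : R => 1 - x) @ 1^'- --> (0 : R)^'+.
Proof.
move=> A [e /= e0 eA]; exists e => //= x xe x1; apply: eA => /=; last by rewrite subr_gt0.
by rewrite sub0r normrN.
Qed.

Lemma one_add_at_right : (fun x : R => 1 + x) @ (-1)^'+ --> (0 : R)^'+.
Proof.
move=> A [e /= e0 eA]; exists e => //= x xe x1; apply: eA => /=; last by rewrite -ltrBlDl sub0r.
by have -> : 0 - (1 + x) = -1 - x by ring.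
Qed.

Lemma is_derive_one_sub_powR a (x : R) : x < 1 ->
  is_derive x 1 (fun y : R => (1 - y) `^ a) (- (a * (1 - x) `^ (a - 1))).
Proof.
move=> x1.
have h : is_derive (1 - x) 1 (fun y : R => y `^ a) (a * (1 - x) `^ (a - 1)).
  by apply: is_derive1_powR; rewrite subr_gt0.
have g : is_derive x 1 (fun y : R => 1 - y) (-1).
  by apply: is_derive_eq; ring.
by have := @is_derive1_comp R (fun y => y `^ a) (fun y => 1 - y) x _ _ h g; rewrite mulrN1.
Qed.

Lemma is_derive_one_add_powR a (x : R) : -1 < x ->
  is_derive x 1 (fun y : R => (1 + y) `^ a) (a * (1 + x) `^ (a - 1)).
Proof.
move=> x1.
have h : is_derive (1 + x) 1 (fun y : R => y `^ a) (a * (1 + x) `^ (a - 1)).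
  by apply: is_derive1_powR; rewrite -ltrBlDl sub0r.
have g : is_derive x 1 (fun y : R => 1 + y) 1.
  by apply: is_derive_eq; ring.
by have := @is_derive1_comp R (fun y => y `^ a) (fun y => 1 + y) x _ _ h g; rewrite mulr1.
Qed.

Lemma within_continuous_one_sub_powR a : 0 < a ->
  {within `[-1, 1], continuous (fun x : R => (1 - x) `^ a)}.
Proof.
move=> a0; have N1 : -1 < 1 :> R by rewrite gtrN.
have cont (x : R) : x < 1 -> {for x, continuous (fun x : R => (1 - x) `^ a)}.
  move=> x1; apply: differentiable_continuous; apply/derivable1_diffP.
  by have [] := is_derive_one_sub_powR a x1.
apply/continuous_within_itvP => //; split.
- by move=> x; rewrite in_itv /= => /andP[_ /cont].
- by apply: cvg_at_right_filter; exact: cont.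
- rewrite subrr powR0 ?gt_eqF//.
  exact: (cvg_comp _ _ one_sub_at_left (powR_cvg0 a0)).
Qed.

Lemma within_continuous_one_add_powR a : 0 < a ->
  {within `[-1, 1], continuous (fun x : R => (1 + x) `^ a)}.
Proof.
move=> a0; have N1 : -1 < 1 :> R by rewrite gtrN.
have cont (x : R) : -1 < x -> {for x, continuous (fun x : R => (1 + x) `^ a)}.
  move=> x1; apply: differentiable_continuous; apply/derivable1_diffP.
  by have [] := is_derive_one_add_powR a x1.
apply/continuous_within_itvP => //; split.
- by move=> x; rewrite in_itv /= => /andP[/cont].
- rewrite subrr powR0 ?gt_eqF//.
  exact: (cvg_comp _ _ one_add_at_right (powR_cvg0 a0)).
- by apply: cvg_at_left_filter; exact: cont.
Qed.

Lemma within_continuous_weight_poly a c p : 0 < a -> 0 < c ->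
  {within `[-1, 1], continuous (fun x : R => jacobi_weight a c x * p.[x])}.
Proof.
move=> a0 c0 x.
apply: cvgM; last exact: (continuous_subspaceT (@continuous_horner _ p)).
apply: cvgM; first exact: within_continuous_one_sub_powR.
exact: within_continuous_one_add_powR.
Qed.

Let mu := @lebesgue_measure R.

Lemma integrable_weight_poly a c p : 0 < a -> 0 < c ->
  mu.-integrable `[-1, 1] (EFin \o (fun x : R => jacobi_weight a c x * p.[x])).
Proof.
move=> a0 c0; apply: continuous_compact_integrable; first exact: segment_compact.
exact: within_continuous_weight_poly.
Qed.

Definition weighted_integral a p : R :=
  \int[mu]_(x in `[-1, 1]) (jacobi_weight a a x * p.[x]).

Lemma weighted_integralD a p q : 0 < a ->
  weighted_integral a (p + q) = weighted_integral a p + weighted_integral a q.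
Proof.
move=> a0; rewrite /weighted_integral -RintegralD//; last 2 first.
- exact: integrable_weight_poly.
- exact: integrable_weight_poly.
by apply: eq_Rintegral => x _; rewrite hornerD mulrDr.
Qed.

Lemma weighted_integralZ a k p : 0 < a ->
  weighted_integral a (k *: p) = k * weighted_integral a p.
Proof.
move=> a0; rewrite /weighted_integral -RintegralZl//; last exact: integrable_weight_poly.
by apply: eq_Rintegral => x _; rewrite hornerZ mulrCA.
Qed.

(** The integrand is the derivative of the weight with exponent a + 1 times p,
    which vanishes at both ends of the interval. *)
Lemma weighted_integral_pearson a p : 0 < a ->
  weighted_integral a ((1 - 'X ^+ 2) * p^`() - (2 * (a + 1)) *: ('X * p)) = 0.
Proof.
move=> a0; have a10 : 0 < a + 1 by apply: addr_gt0.
pose F x : R := jacobi_weight (a + 1) (a + 1) x * p.[x].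
have N1 : -1 < 1 :> R by rewrite gtrN.
have cF : {within `[-1, 1], continuous F} by exact: within_continuous_weight_poly.
have dF (x : R) : x \in `]-1, 1[ -> is_derive x 1 F
    (jacobi_weight a a x * ((1 - 'X ^+ 2) * p^`() - (2 * (a + 1)) *: ('X * p)).[x]).
  rewrite in_itv /= => /andP[xN1 x1].
  have d1 := is_derive_one_sub_powR (a + 1) x1.
  have d2 := is_derive_one_add_powR (a + 1) xN1.
  have d3 : is_derive x 1 (horner p) (p^`()).[x].
    split; first exact: derivable_horner.
    by rewrite derivE derive1E.
  rewrite /F /jacobi_weight; apply: is_derive_eq.
  rewrite !(hornerD, hornerN, hornerM, hornerZ, hornerX, hornerXn, hornerC) /GRing.scale /=.
  have e1 : (1 - x) * (1 - x) `^ a = (1 - x) `^ (a + 1).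
    by rewrite -{1}[a](addrK 1) mulr_powRB1// subr_ge0 ltW.
  have e2 : (1 + x) * (1 + x) `^ a = (1 + x) `^ (a + 1).
    by rewrite -{1}[a](addrK 1) mulr_powRB1// -lerBlDl sub0r ltW.
  rewrite addrK -e1 -e2; ring.
rewrite /weighted_integral /Rintegral (@continuous_FTC2 _ _ F)//.
- rewrite /F /jacobi_weight subrr powR0 ?gt_eqF//.
  by rewrite !(mul0r, mulr0) -EFinB subrr.
- exact: within_continuous_weight_poly.
- have [_ l r] := (continuous_within_itvP _ N1).1 cF.
  by split => // x /dF [].
- by move=> x /dF [_ <-]; rewrite derive1E.
Qed.

Lemma weighted_integral1_gt0 a : 0 < a -> 0 < weighted_integral a 1.
Proof.
move=> a0; pose f x : R := jacobi_weight a a x * (1 : {poly R}).[x].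
pose I : set R := `[-1, 1]%classic; pose J : set R := `[-(1 / 2), 1 / 2]%classic.
have [mI mJ] : measurable I /\ measurable J by split; exact: measurable_itv.
have fint : mu.-integrable I (EFin \o f) by exact: integrable_weight_poly.
pose c : R := (1 / 2) `^ a * (1 / 2) `^ a.
have c0 : 0 < c by apply: mulr_gt0; apply: powR_gt0; lra.
suff cI : (c%:E <= \int[mu]_(x in I) (f x)%:E)%E.
  rewrite -lte_fin /weighted_integral /Rintegral fineK; last exact: integrable_fin_num.
  by apply: lt_le_trans cI; rewrite lte_fin.
have f0 x : 0 <= f x by rewrite /f hornerC mulr1 mulr_ge0// powR_ge0.
have fle (x : R) : x \in `[-(1 / 2), 1 / 2] -> c <= f x.
  rewrite in_itv /= => /andP[x1 x2]; rewrite /f hornerC mulr1.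
  by apply: ler_pM; rewrite ?powR_ge0//; apply: ge0_ler_powR; rewrite ?nnegrE; lra.
have sub : J `<=` I.
  by apply: subset_itv; rewrite bnd_simp; lra.
apply: (@le_trans _ _ (\int[mu]_(x in J) (f x)%:E)%E); last first.
  apply: ge0_subset_integral => //; last by move=> x _; rewrite lee_fin.
  exact: (measurable_int mu fint).
apply: (@le_trans _ _ (\int[mu]_(x in J) cst (c%:E) x)%E).
  rewrite integral_cst//= lebesgue_measure_itv /= lte_fin ifT; last lra.
  by rewrite -EFinB -EFinM lee_fin; lra.
apply: ge0_le_integral => //.
- by move=> x _; rewrite lee_fin ltW.
- exact: (measurable_funS mI sub (measurable_int mu fint)).
Qed.
End Weight.

(** * Orthogonality *)

Section OrthogonalSequence.
Variables (R : fieldType) (Phi : {poly R} -> R).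
Hypothesis PhiD : forall p q, Phi (p + q) = Phi p + Phi q.
Hypothesis PhiZ : forall c p, Phi (c *: p) = c * Phi p.

Definition orthogonal_seq (P : nat -> {poly R}) : Prop :=
  (forall n, size (P n) = n.+1) /\ (forall m n, m <> n -> Phi (P m * P n) = 0).

Lemma size_sub_lead (p q : {poly R}) n : (size p <= n.+1)%N -> size q = n.+1 ->
  exists c, (size (p - c *: q)%R <= n)%N /\ (size p = n.+1 -> c != 0).
Proof.
move=> sp sq; exists (p`_n / lead_coef q); split.
  apply/leq_sizeP => j; rewrite leq_eqVlt => /orP[/eqP<-|nj].
    rewrite coefB coefZ lead_coefE sq /= divfK ?subrr//.
    by have := lead_coef_eq0 q; rewrite lead_coefE sq /= -size_poly_eq0 sq => ->.
  rewrite nth_default//; apply: leq_trans nj.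
  rewrite (leq_trans (size_polyD _ _))// geq_max sp size_polyN.
  by rewrite (leq_trans (size_scale_leq _ _))// sq.
move=> sp1; apply: mulf_neq0; last by rewrite invr_eq0 lead_coef_eq0 -size_poly_eq0 sq.
by have := lead_coef_eq0 p; rewrite lead_coefE sp1 /= -size_poly_eq0 sp1 => ->.
Qed.

Lemma orthogonal_low P n (p : {poly R}) : orthogonal_seq P -> (size p <= n)%N ->
  Phi (p * P n) = 0.
Proof.
move=> [sP oP]; suff low m : (m <= n)%N -> forall q : {poly R}, (size q <= m)%N ->
  Phi (q * P n) = 0.
  by apply: low.
have Phi0 : Phi 0 = 0 by rewrite -(scale0r 0) PhiZ mul0r.
elim: m => [_ q|m IH mn q sq]; first by rewrite leqn0 size_poly_eq0 => /eqP->; rewrite mul0r.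
have [c [sc _]] := size_sub_lead sq (sP m).
rewrite -[q](subrK (c *: P m)) mulrDl PhiD IH ?(ltnW mn)// -scalerAl PhiZ oP ?mulr0 ?addr0//.
by move=> e; rewrite e ltnn in mn.
Qed.

(** The difference of P n and the multiple of Q n with the same leading term has degree
    m < n and is orthogonal to Q m, although its component along Q m is nonzero
    unless it vanishes. *)
Lemma orthogonal_unique P Q : orthogonal_seq P -> orthogonal_seq Q ->
  (forall n, Phi (Q n * Q n) != 0) -> forall n, exists2 c, c != 0 & P n = c *: Q n.
Proof.
move=> oP oQ nQ n.
have [c [sc cn0]] := size_sub_lead (eq_leq (oP.1 n)) (oQ.1 n).
exists c; first by apply: cn0; exact: oP.1.
apply/eqP; rewrite -subr_eq0; set r := _ - _ in sc *; apply/negPn/negP => r0.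
have [m sm] : exists m, size r = m.+1 by exists (size r).-1; rewrite prednK// size_poly_gt0.
have mn : (m < n)%N by rewrite -sm.
have [d [sd dn0]] := size_sub_lead (eq_leq sm) (oQ.1 m).
have : Phi (r * Q m) = 0.
  rewrite /r -scaleN1r scalerA mulrDl PhiD -scalerAl PhiZ.
  rewrite [P n * _]mulrC [Q n * _]mulrC !orthogonal_low ?oQ.1 ?mulr0 ?addr0//.
rewrite -[r](subrK (d *: Q m)) mulrDl PhiD orthogonal_low// add0r -scalerAl PhiZ.
by apply/eqP; rewrite mulf_neq0// dn0.
Qed.
End OrthogonalSequence.

Lemma poly_ext (R : realFieldType) (p q : {poly R}) : (forall x, p.[x] = q.[x]) -> p = q.
Proof.
move=> e; apply/eqP; rewrite -subr_eq0; apply/eqP.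
apply: (@roots_geq_poly_eq0 _ _ [seq i%:R | i <- iota 0 (size (p - q))]).
- by apply/allP => x _; rewrite rootE hornerD hornerN e subrr.
- by rewrite map_inj_uniq ?iota_uniq//; exact: mulrIn (oner_neq0 _).
- by rewrite size_map size_iota.
Qed.

Section Ode.
Variables (R : realFieldType) (b : R).
Hypothesis b_gt0 : 0 < b.
Local Notation U := (gegen b).

(** The two derivative formulas are proved together because each one, at degree
    n + 1, follows from both at degree n and the recurrence. *)
Lemma gegen_deriv n x :
  (1 - x ^+ 2) * (U n.+1)^`().[x] = n.+1%:R * ((U n).[x] - x * (U n.+1).[x]) /\
  (1 - x ^+ 2) * (U n)^`().[x] = (n%:R + b) * (x * (U n).[x] - (U n.+1).[x]).
Proof.
elim: n => [|n [A B]].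
  by rewrite /= derivC derivX !hornerE; split; ring.
have h : n.+1%:R + b != 0 by rewrite gt_eqF// addr_gt0.
have r := gegen_rec b_gt0 n x.
split; last first.
  by rewrite A [RHS]mulrBr r; ring.
apply: (mulfI h).
have -> : (n.+1%:R + b) * ((1 - x ^+ 2) * (U n.+2)^`().[x]) =
   (2 * n.+1%:R + b) * ((1 - x ^+ 2) * (U n.+1).[x] + x * ((1 - x ^+ 2) * (U n.+1)^`().[x]))
     - n.+1%:R * ((1 - x ^+ 2) * (U n)^`().[x]).
  rewrite [U n.+2]/= -/(U n.+1) derivZ derivB !derivZ derivM derivX.
  rewrite !(hornerZ, hornerD, hornerN, hornerM, hornerX, hornerC).
  by rewrite mulrCA mulVKf//; ring.
have -> : (n.+1%:R + b) * (n.+2%:R * ((U n.+1).[x] - x * (U n.+2).[x])) =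
  n.+2%:R * ((n.+1%:R + b) * (U n.+1).[x] - x * ((n.+1%:R + b) * (U n.+2).[x])) by ring.
by rewrite A B r; ring.
Qed.

Lemma gegen_ode n :
  (1 - 'X ^+ 2) * (U n)^`()^`() - (b + 1)%:P * 'X * (U n)^`() = - (n%:R * (n%:R + b))%:P * U n.
Proof.
case: n => [|n]; first by rewrite /= derivC deriv0 !mulr0 subr0 mul0r oppr0 mul0r.
have X0 : 1 - 'X ^+ 2 != 0 :> {poly R}.
  apply/negP => /eqP/(congr1 (fun p => p.[0])); rewrite !hornerE expr0n subr0.
  by move/eqP; rewrite oner_eq0.
apply: (mulfI X0); apply: poly_ext => x.
have e : (1 - 'X ^+ 2) * (U n.+1)^`() = n.+1%:R%:P * (U n - 'X * U n.+1).
  apply: poly_ext => y; have [A _] := gegen_deriv n y.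
  by rewrite !(hornerM, hornerD, hornerN, hornerXn, hornerX, hornerC) A.
have := congr1 (fun p => p^`().[x]) e.
rewrite !derivM !derivB !derivM !derivX !derivC.
rewrite !(hornerM, hornerD, hornerN, hornerXn, hornerX, hornerC, hornerMn).
have [A B] := gegen_deriv n x.
set D1 := (U n.+1)^`().[x] in A *; set D2 := (U n.+1)^`()^`().[x]; set D0 := (U n)^`().[x] in
  B *.
move: (U n).[x] (U n.+1).[x] A B => u0 u1 A B C.
rewrite -natr1 in A C *; move: (n%:R : R) A B C => N A B C.
have C' : (1 - x ^+ 2) * D2 = 2 * x * D1 + (N + 1) * (D0 - u1 - x * D1) by lra.
have -> : (1 - x * x) * ((1 - x * x) * D2 - (b + 1) * x * D1) =
  (1 - x ^+ 2) * ((1 - x ^+ 2) * D2) - (b + 1) * x * ((1 - x ^+ 2) * D1) by ring.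
rewrite C'.
have -> : (1 - x ^+ 2) * (2 * x * D1 + (N + 1) * (D0 - u1 - x * D1)) =
  2 * x * ((1 - x ^+ 2) * D1) + (N +
    1) * ((1 - x ^+ 2) * D0 - (1 - x ^+ 2) * u1 - x * ((1 - x ^+ 2) * D1)) by ring.
rewrite A B; ring.
Qed.
End Ode.

Section JacobiFamilies.
Variables (R : realType) (a : R).
Hypothesis a_gt0 : 0 < a.
Let b := 2 * a + 1.
Let b_gt0 : 0 < b. Proof. by rewrite /b; have := a_gt0; lra. Qed.
Local Notation U := (gegen b).
Local Notation K := (kern b).
Local Notation L := (weighted_integral a).

Let LD p q : L (p + q) = L p + L q. Proof. exact: weighted_integralD. Qed.
Let LZ c p : L (c *: p) = c * L p. Proof. exact: weighted_integralZ. Qed.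

Let Llin (c d : R) (p q r : {poly R}) :
  L ((c *: p + d *: q) * r) = c * L (p * r) + d * L (q * r).
Proof. by rewrite mulrDl LD -!scalerAl !LZ. Qed.

(** The Wronskian of two solutions, inserted in [weighted_integral_pearson], yields the
    difference of the eigenvalues times the inner product. *)
Lemma gegen_orthogonal : orthogonal_seq L U.
Proof.
split; first exact: size_gegen.
move=> m n mn.
have := weighted_integral_pearson (U m * (U n)^`() - U n * (U m)^`()) a_gt0.
have -> : 2 * (a + 1) = b + 1 by rewrite /b; ring.
have -> : (1 - 'X ^+ 2) * (U m * (U n)^`() - U n * (U m)^`())^`() - (b +
  1) *: ('X * (U m * (U n)^`() - U n * (U m)^`()))
  = (m%:R * (m%:R + b) - n%:R * (n%:R + b)) *: (U m * U n).
  rewrite derivB !derivM -!mul_polyC.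
  have -> : forall p p1 p2 q q1 q2 c : {poly R},
    (1 - 'X ^+ 2) * (p1 * q1 + p * q2 - (q1 * p1 + q * p2)) - c * ('X * (p * q1 - q * p1))
    = p * ((1 - 'X ^+ 2) * q2 - c * 'X * q1) - q * ((1 - 'X ^+ 2) * p2 - c * 'X * p1).
    by move=> *; ring.
  rewrite !gegen_ode// polyCB; ring.
rewrite LZ => /eqP; rewrite mulf_eq0 => /orP[|/eqP//].
have -> : m%:R * (m%:R + b) - n%:R * (n%:R + b) =
  (m%:R - n%:R) * (m%:R + n%:R + b) :> R by ring.
rewrite mulf_eq0 subr_eq0 eqr_nat => /orP[/eqP//|].
by rewrite gt_eqF// -natrD addrC ltr_wpDr.
Qed.

Let low n (p : {poly R}) : (size p <= n)%N -> L (p * U n) = 0.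
Proof. by move=> sp; apply: (orthogonal_low LD LZ gegen_orthogonal sp). Qed.

(** The inner product of 'X U n with U n.+1, computed with the recurrence at n and at
    n.+1, expresses each squared norm as a nonzero multiple of the previous one;
    thus only the total mass has to be shown to be positive. *)
Lemma gegen_norm n : L (U n * U n) != 0.
Proof.
elim: n => [|n IH]; first by rewrite /= mulr1 gt_eqF// weighted_integral1_gt0.
have XU m : (2 * m.+1%:R + b) *: ('X * U m.+1) = (m.+1%:R + b) *: U m.+2 + m.+1%:R *: U m.
  apply: poly_ext => x; rewrite hornerZ hornerM hornerX [in RHS]hornerD.
  rewrite [((_ + b) *: U m.+2).[x]]hornerZ [(_ *: U m).[x]]hornerZ gegen_rec//; ring.
have up : (2 * n.+1%:R + b) * L ('X * U n.+1 * U n) = n.+1%:R * L (U n * U n).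
  rewrite -LZ scalerAl XU Llin gegen_orthogonal.2 ?mulr0 ?add0r//.
  by apply/eqP; rewrite gtn_eqF// ltnS leqnSn.
have down : (2 * n%:R + b) * L ('X * U n * U n.+1) = (n%:R + b) * L (U n.+1 * U n.+1).
  case: n {IH up} => [|n]; first by rewrite !(mulr0, add0r) /= mulr1.
  rewrite -LZ scalerAl XU Llin [X in _ + _ * X]gegen_orthogonal.2 ?mulr0 ?addr0//.
  by apply/eqP; rewrite ltn_eqF// ltnS leqnSn.
apply/negP => /eqP h; rewrite h mulr0 in down.
have p1 : 2 * n%:R + b != 0 by rewrite gt_eqF// ltr_wpDl// mulr_ge0.
move/eqP: down; rewrite mulf_eq0 (negbTE p1) /= => /eqP XL.
have : L ('X * U n.+1 * U n) = 0 by rewrite -mulrA [U n.+1 * _]mulrC mulrA.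
move=> z; move: up; rewrite z mulr0 => /esym/eqP; rewrite mulf_eq0 (negbTE IH) orbF.
by rewrite pnatr_eq0.
Qed.

Let L1 (p : {poly R}) := L ((1 - 'X) * p).

Lemma kern_factor n : (1 - 'X) * K n = U n - U n.+1.
Proof.
apply: poly_ext => x; rewrite !(hornerD, hornerN, hornerM, hornerX, hornerC).
by rewrite gegen_diff.
Qed.

(** The extra factor 1 - x of the second weight turns [kern n] into
    [gegen n - gegen n.+1]. *)
Lemma kern_low n (p : {poly R}) : (size p <= n)%N -> L1 (p * K n) = 0.
Proof.
move=> sp; rewrite /L1 mulrCA kern_factor mulrBr -scaleN1r LD LZ.
by rewrite !low ?mulr0 ?addr0// leqW.
Qed.

Lemma kern_orthogonal : orthogonal_seq L1 K.
Proof.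
split=> [n|m n mn]; first exact: size_kern.
have [lt|gt|//] := ltngtP m n; first by apply: kern_low; rewrite size_kern.
by rewrite mulrC; apply: kern_low; rewrite size_kern.
Qed.

Lemma kern_norm n : L1 (K n * K n) != 0.
Proof.
rewrite /L1 mulrCA kern_factor mulrBr -scaleN1r LD LZ.
rewrite [X in _ + _ * X]low ?size_kern// mulr0 addr0.
case: n => [|n]; first exact: (gegen_norm 0).
have h : n.+1%:R + b != 0 by rewrite gt_eqF// addr_gt0.
rewrite [K n.+1]/= -/(gegen b n.+1) -scalerAl LZ Llin low ?size_kern//.
by rewrite mulr0 add0r !mulf_neq0 ?invr_eq0 ?gegen_norm// gt_eqF// addr_gt0// mulr_gt0.
Qed.

End JacobiFamilies.

(** * Identification with the Jacobi polynomials *)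

Section Identification.
Local Open Scope classical_set_scope.
Local Open Scope ring_scope.
Variables (R : realType) (a : R).
Hypothesis a_gt0 : 0 < a.
Let b := 2 * a + 1.
Let b_gt0 : 0 < b. Proof. by rewrite /b; have := a_gt0; lra. Qed.

(** The chosen family exists because Q can be rescaled to the prescribed values at 1;
    by uniqueness it is then proportional to Q, and the normalisation at 1 removes
    the proportionality factor. *)
Lemma jacobi_family (c d : R) (Phi : {poly R} -> R) (Q : nat -> {poly R}) :
  0 < c ->
  (forall p q, Phi (p + q) = Phi p + Phi q) -> (forall k p, Phi (k *: p) = k * Phi p) ->
  (forall p q : {poly R}, \int[lebesgue_measure]_(x in `[-1, 1]%classic)
     (jacobi_weight c d x * p.[x] * q.[x]) = Phi (p * q)) ->
  orthogonal_seq Phi Q -> (forall n, Phi (Q n * Q n) != 0) -> (forall n, (Q n).[1] != 0) ->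
  forall n, jacobiR c d n = (Q n).[1]^-1 *: Q n.
Proof.
move=> c0 PhiD PhiZ PhiE oQ nQ Q1 n.
pose l n : R := \prod_(i < n) ((c + i.+1%:R) / i.+1%:R).
have l0 m : l m != 0.
  apply/prodf_neq0 => i _; rewrite mulf_neq0// ?invr_eq0// gt_eqF// addr_gt0//.
have ex : is_jacobi c d (fun n => (l n / (Q n).[1]) *: Q n).
  split=> [m|m k mk|m].
  - by rewrite size_scale ?oQ.1// mulf_neq0 ?invr_eq0.
  - by rewrite PhiE -scalerAl -scalerAr !PhiZ oQ.2// !mulr0.
  - by rewrite hornerZ divfK.
have jac : is_jacobi c d (jacobi c d) by apply: (xgetPex _ (ex_intro _ _ ex)).
have [sJ oJ J1] := jac.
have oJ' : orthogonal_seq Phi (jacobi c d).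
  by split=> // m k mk; rewrite -PhiE oJ.
have [k k0 e] := orthogonal_unique PhiD PhiZ oJ' oQ nQ n.
by rewrite /jacobiR e hornerZ scalerA invfM mulrAC mulVf// mul1r.
Qed.

Lemma jacobiR_gegen n : jacobiR a a n = gegen b n.
Proof.
rewrite (@jacobi_family a a (weighted_integral a) (gegen b))//.
- by rewrite gegen_at1// invr1 scale1r.
- by move=> *; exact: weighted_integralD.
- by move=> *; exact: weighted_integralZ.
- by move=> p q; apply: eq_Rintegral => x _; rewrite hornerM mulrA.
- exact: gegen_orthogonal.
- exact: gegen_norm.
- by move=> m; rewrite gegen_at1// oner_neq0.
Qed.

Lemma jacobiR_kern n : jacobiR (a + 1) a n = (kern b n).[1]^-1 *: kern b n.
Proof.
apply: (@jacobi_family _ _ (fun p => weighted_integral a ((1 - 'X) * p)) (kern b)).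
- by rewrite addr_gt0.
- by move=> p q; rewrite mulrDr; exact: weighted_integralD.
- by move=> k p; rewrite -scalerAr; exact: weighted_integralZ.
- move=> p q; apply: eq_Rintegral => x; rewrite inE /= in_itv /= => /andP[_ x1].
  rewrite /jacobi_weight -[in LHS](@mulr_powRB1 _ (1 - x) (a + 1)) ?subr_ge0 ?addr_gt0// addrK.
  by rewrite !(hornerM, hornerD, hornerN, hornerX, hornerC); ring.
- exact: kern_orthogonal.
- exact: kern_norm.
- by move=> m; rewrite gt_eqF// kern_at1_gt0.
Qed.

Lemma is_xi_xi n : is_xi b n (xi a n).
Proof.
case: n => [//|n]; rewrite /xi jacobiR_kern.
set k := _^-1; have k0 : k != 0 by rewrite invr_eq0 gt_eqF// kern_at1_gt0.
have [_ [r [_ [Kr pos] _ _ _]]] := is_xi_chain b_gt0 n.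
have lr : [set r | root (k *: kern b n.+1) r /\ forall s, root (k *: kern b n.+1) s ->
  s <= r] r.
  split; first by rewrite rootZ// rootE Kr.
  move=> s; rewrite rootZ// rootE => /eqP s0; rewrite leNgt; apply/negP => /pos.
  by rewrite s0 ltxx.
have [xr xmax] : [set r | root (k *: kern b n.+1) r /\ forall s, root (k *: kern b n.+1) s ->
  s <= r]
   (largest_root (k *: kern b n.+1)) by apply: (xgetPex _ (ex_intro _ r lr)).
have -> : largest_root (k *: kern b n.+1) = r; last by split.
by apply/eqP; rewrite eq_le (xmax _ lr.1) (lr.2 _ xr).
Qed.

End Identification.

Theorem proposition6p3 (R : realType) (alpha x : R)
    (alpha_gt0 : 0 < alpha) (x_gtN1 : -1 < x) (x_lt1 : x < 1) :
  let U := fun n : nat => (jacobiR alpha alpha n).[x] in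
  (forall k : nat, (1 <= k)%N ->
     (min_attained_at U k <-> xi alpha k.-1 <= x <= xi alpha k)) /\
  (forall k : nat, (1 <= k)%N ->
     (xi alpha k.-1 < x < xi alpha k ->
        forall m : nat, min_attained_at U m <-> m = k) /\
     (x = xi alpha k ->
        forall m : nat, min_attained_at U m <-> m = k \/ m = k.+1)) /\
  (forall k : nat, min_attained_at U k ->
     forall j : nat, (j < k)%N -> U j.+1 <= U j).
Proof.
have b1 : 1 < 2 * alpha + 1 by lra.
have UE : (fun n => (jacobiR alpha alpha n).[x]) = (fun n => (gegen (2 * alpha + 1) n).[x]).
  by apply/funext => n; rewrite jacobiR_gegen.
rewrite UE; exact: (gegen_minima b1 x_gtN1 x_lt1 (is_xi_xi alpha_gt0)).
Qed.
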